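(* Let $f:\mathbb{B}^n\to \mathbb{B}^n$ be holomorphic. Assume that $e_1$ is a boundary super-regular fixed point of $f$. Then for every $\eta>0$ and $M>1$ there exist $s\in (0,1)$ and $r>0$ such that $$\bigcup_{\zeta \in K(M,s)} B_k(f(\zeta e_1), r)\subset f(\mathbb{B}^n\cap\mathbb{B}(e_1,\eta)),$$ where $B_k(x,R)$ denotes the Kobayashi ball of center $x\in \mathbb{B}^n$ and radius $R>0$.
   Context: $\mathbb{B}(a,r)=\{z\in\mathbb{C}^n:\|z-a\|<r\}$ is the Euclidean ball, $\mathbb{B}^n=\mathbb{B}(0,1)$, $e_1=(1,0,\ldots,0)\in\mathbb{C}^n$, $\mathbb{D}$ is the unit disc in $\mathbb{C}$. The Kobayashi distance of $\mathbb{B}^n$ is $k_{\mathbb{B}^n}(a,b)=\frac12\log\frac{1+\|T_a(b)\|}{1-\|T_a(b)\|}$, where $T_a$ is any automorphism of $\mathbb{B}^n$ with $T_a(a)=0$; $B_k(x,R)=\{z\in\mathbb{B}^n:k_{\mathbb{B}^n}(x,z)<R\}$. For $M>1$ and $s>0$, the Stolz angle is $K(M,s):=\{\zeta\in\mathbb{D}:\frac{|1-\zeta|}{1-|\zeta|}<M,\ |1-\zeta|<s\}$. For $f:\mathbb{B}^n\to\mathbb{B}^n$ holomorphic, $e_1$ is a boundary regular fixed point of $f$ if $\liminf_{z\to e_1}\frac{1-\|f(z)\|}{1-\|z\|}<+\infty$ and $\lim_{(0,1)\ni r\to1}f(re_1)=e_1$. It is a boundary super-regular fixed point of $f$ if it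 is a boundary regular fixed point and moreover for each $M>1$ there exists $c=c(M)>0$ such that for any sequence $\{\zeta_k\}\subset K(M,2)$ tending to $1$ one has $\liminf_{k\to\infty}|\det(df_{\zeta_ke_1})|\ge c$ ($\det df_z$ being the complex Jacobian determinant). *)

(* Defs.v *)
From HB Require Import structures.
From mathcomp Require Import all_boot all_order all_algebra.
From mathcomp Require Import complex.
From mathcomp Require Import boolp classical_sets functions reals ereal.
From mathcomp Require Import topology normedtype sequences derive exp.

Set Implicit Arguments.
Unset Strict Implicit.
Unset Printing Implicit Defensive.

Import Order.TTheory GRing.Theory Num.Theory.
Import numFieldNormedType.Exports.

Local Open Scope classical_set_scope.
Local Open Scope ring_scope.
Local Open Scope complex_scope.

(* The library only puts the topology of K^o on abstract number fields K: these
   instances extend it to the concrete field R[i], definitionally. *)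
#[non_forgetful_inheritance]
HB.instance Definition _ (R : rcfType) := GRing.ComAlgebra.copy R[i] R[i]^o.
#[non_forgetful_inheritance]
HB.instance Definition _ (R : rcfType) := Vector.copy R[i] R[i]^o.
#[non_forgetful_inheritance]
HB.instance Definition _ (R : rcfType) := NormedModule.copy R[i] R[i]^o.

(* C^n is 'rV[R[i]]_n.  Its library norm is the sup norm, valued in R[i]; it
   induces the usual topology and hence the usual limits and differentials,
   but the Euclidean norm has to be defined separately. *)
Definition cabs (R : realType) (z : R[i]) : R := complex.Re `|z|.

Definition enorm (R : realType) (n : nat) (z : 'rV[R[i]]_n) : R :=
  Num.sqrt (\sum_(j < n) cabs (z ord0 j) ^+ 2).

Definition eball (R : realType) (n : nat) (a : 'rV[R[i]]_n) (r : R) :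
  set 'rV[R[i]]_n := [set z | enorm (z - a) < r].

Definition unit_ball (R : realType) (n : nat) : set 'rV[R[i]]_n := eball 0 1.

Definition e1 (R : realType) (n : nat) : 'rV[R[i]]_n.+1 := delta_mx ord0 ord0.

(* [differentiable] is relative to the scalar field R[i], that is, complex. *)
Definition holomorphic_on (R : realType) (n m : nat) (U : set 'rV[R[i]]_n)
  (f : 'rV[R[i]]_n -> 'rV[R[i]]_m) : Prop :=
  forall z, U z -> differentiable f z.

(* Maps on the ball are total functions of which only the values on the ball
   matter. *)
Definition holomorphic_self_map (R : realType) (n : nat)
  (f : 'rV[R[i]]_n -> 'rV[R[i]]_n) : Prop :=
  holomorphic_on (@unit_ball R n) f /\
  set_fun (@unit_ball R n) (@unit_ball R n) f.

Definition ball_automorphism (R : realType) (n : nat)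
  (T : 'rV[R[i]]_n -> 'rV[R[i]]_n) : Prop :=
  holomorphic_self_map T /\
  exists2 S : 'rV[R[i]]_n -> 'rV[R[i]]_n, holomorphic_self_map S &
    {in @unit_ball R n, cancel T S} /\ {in @unit_ball R n, cancel S T}.

(* Some automorphism taking a to 0, meaningful for a in the ball: one then
   exists, and any two differ on the ball by a unitary map, so
   [kobayashi_dist a] does not depend on the choice there. *)
Definition to_origin (R : realType) (n : nat) (a : 'rV[R[i]]_n) :
  'rV[R[i]]_n -> 'rV[R[i]]_n :=
  xget (id : 'rV[R[i]]_n -> 'rV[R[i]]_n)
    [set T | ball_automorphism T /\ T a = 0].

Definition kobayashi_dist (R : realType) (n : nat) (a b : 'rV[R[i]]_n) : R :=
  2^-1 * ln ((1 + enorm (to_origin a b)) / (1 - enorm (to_origin a b))).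

Definition kobayashi_ball (R : realType) (n : nat) (x : 'rV[R[i]]_n) (r : R) :
  set 'rV[R[i]]_n := [set z | unit_ball z /\ kobayashi_dist x z < r].

Definition stolz_angle (R : realType) (M s : R) : set R[i] :=
  [set z | [/\ cabs z < 1, cabs (1 - z) / (1 - cabs z) < M &
               cabs (1 - z) < s]].

Definition boundary_regular_fixed_point (R : realType) (n : nat)
  (f : 'rV[R[i]]_n.+1 -> 'rV[R[i]]_n.+1) : Prop :=
  (limf_einf (fun z => ((1 - enorm (f z)) / (1 - enorm z))%:E)
     (within (@unit_ball R n.+1) (nbhs (e1 R n))) < +oo)%E /\
  f (r%:C *: e1 R n) @[r --> (1 : R)^'-] --> e1 R n.

(* [jacobian] acts on row vectors: it is the transpose of the usual Jacobian
   matrix, with the same determinant. *)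
Definition boundary_super_regular_fixed_point (R : realType) (n : nat)
  (f : 'rV[R[i]]_n.+1 -> 'rV[R[i]]_n.+1) : Prop :=
  boundary_regular_fixed_point f /\
  forall M : R, 1 < M -> exists2 c : R, 0 < c &
    forall zeta : nat -> R[i],
      (forall k, stolz_angle M 2 (zeta k)) ->
      zeta k @[k --> \oo] --> (1 : R[i]) ->
      (c%:E <= limn_einf
        (fun k => (cabs (\det (jacobian f (zeta k *: e1 R n))))%:E))%E.

(* Main.v *)
Require Import Defs.
From mathcomp Require Import all_boot all_order all_algebra.
From mathcomp Require Import complex.
From mathcomp Require Import perm ring lra.
From mathcomp Require Import boolp classical_sets functions reals ereal.
From mathcomp Require Import topology normedtype sequences landau derive exp.

Set Implicit Arguments.
Unset Strict Implicit.
Unset Printing Implicit Defensive.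

Import Order.TTheory GRing.Theory Num.Theory.
Import numFieldNormedType.Exports.

Local Open Scope classical_set_scope.
Local Open Scope ring_scope.

(** Let zeta tend to 1 inside a Stolz angle and put w = f(zeta e_1).  Rescaling
turns the local behaviour of f at zeta e_1 into that of a bounded map of the
ball fixing the origin.  On the source side the ball is rescaled by an affine
chart centred at zeta e_1, of size 1 - |zeta| in the direction e_1 and
sqrt(1 - |zeta|) in the others; on the target side by the involutive
automorphism of the ball exchanging w and 0.  The resulting map h sends the
unit ball into itself and 0 to 0.  Its Jacobian determinant at 0 is that of f
multiplied, up to a constant, by the power N + 1 of
sqrt(1 - |zeta|) / sqrt(1 - |w|^2), where N is the dimension.  This ratio is
bounded below on the Stolz angle: the Schwarz-Pick inequality between zeta e_1
and points tending to e_1 along which the boundary dilation quotient stays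
bounded gives 1 - |f(zeta e_1)| <= C (1 - |zeta|) ([julia_stolz]).  The
determinant of f is bounded below by super-regularity ([super_regular_det]).

A holomorphic self-map of the ball that fixes 0, with Jacobian determinant
bounded below at 0, covers a ball of radius bounded below
([open_mapping_det]).  Undoing the target automorphism, f maps the image of
the chart onto a set containing a Kobayashi ball of fixed radius around w
([kobayashi_ball_mob]), and the image of the chart lies close to e_1.

The function theory behind this is the Schwarz lemma, and it is obtained from
Goursat's lemma without a Cauchy integral formula.  Goursat's bisection is
carried out on trapezoid sums along squares.  Applied to the powers of
p(w) conj(p(w')), with w' the mirror image of w in a line, which is holomorphic
and equals |p|^2 on that line, it bounds |p| at a point of the line by its
values around the point ([local_max]).  A perturbation makes this bound strict
at a hypothetical interior maximum ([maximum_principle]), and the Schwarz lemma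
follows by applying the maximum principle to g^(k+1) / z^k for all k
([schwarz_disc], [schwarz_lemma]).  The second order estimates that the open
mapping theorem needs come from applying the Schwarz lemma twice, to
increments of h and then to increments of these increments, so that no higher
derivative is ever considered. *)

(** * The modulus of complex numbers *)

Section Modulus.
Variable R : realType.
Implicit Types z w : R[i].
Local Open Scope complex_scope.

Lemma cabsE z : `|z| = (cabs z)%:C.
Proof. by rewrite /cabs; case: z => a b; rewrite normc_def. Qed.

Lemma cabs_ge0 z : 0 <= cabs z.
Proof. by rewrite -ler0c -cabsE normr_ge0. Qed.

Lemma cabsM z w : cabs (z * w) = cabs z * cabs w.
Proof. by apply: complexI; rewrite rmorphM /= -!cabsE normrM. Qed.

Lemma cabsD z w : cabs (z + w) <= cabs z + cabs w.
Proof. by rewrite -lecR rmorphD /= -!cabsE ler_normD. Qed.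

Lemma cabsN z : cabs (- z) = cabs z.
Proof. by apply: complexI; rewrite -!cabsE normrN. Qed.

Lemma cabsB z w : cabs (z - w) = cabs (w - z).
Proof. by rewrite -cabsN opprB. Qed.

Lemma cabs0 : cabs (0 : R[i]) = 0.
Proof. by apply: complexI; rewrite -!cabsE normr0. Qed.

Lemma cabs1 : cabs (1 : R[i]) = 1.
Proof. by apply: complexI; rewrite -!cabsE normr1. Qed.

Lemma cabs0P z : cabs z = 0 -> z = 0.
Proof. by move=> h; apply: normr0_eq0; rewrite cabsE h. Qed.

Lemma cabs_gt0 z : z != 0 -> 0 < cabs z.
Proof. by move=> h; rewrite lt0r cabs_ge0 andbT; apply: contraNneq h => /cabs0P->. Qed.

Lemma cabsX z n : cabs (z ^+ n) = cabs z ^+ n.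
Proof. by elim: n => [|n IH]; rewrite ?expr0 ?cabs1 // !exprS cabsM IH. Qed.

Lemma cabsV z : cabs z^-1 = (cabs z)^-1.
Proof. by apply: complexI; rewrite fmorphV /= -!cabsE normfV. Qed.

Lemma cabs_real (x : R) : cabs x%:C = `|x|.
Proof. by rewrite /cabs normc_def /= expr0n /= addr0 sqrtr_sqr. Qed.

Lemma cabsJ z : cabs (Num.conj z) = cabs z.
Proof. by apply: complexI; rewrite -!cabsE normcJ. Qed.

Lemma conj_real (x : R) : Num.conj (x%:C : R[i]) = x%:C.
Proof. exact: conjc_real. Qed.

Lemma real_complexD (x y : R) : (x + y)%:C = x%:C + y%:C :> R[i].
Proof. exact: rmorphD. Qed.

Lemma real_complexB (x y : R) : (x - y)%:C = x%:C - y%:C :> R[i].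
Proof. exact: rmorphB. Qed.

Lemma real_complexM (x y : R) : (x * y)%:C = x%:C * y%:C :> R[i].
Proof. exact: rmorphM. Qed.

Lemma real_complexV (x : R) : (x^-1)%:C = (x%:C)^-1 :> R[i].
Proof. exact: fmorphV. Qed.

Lemma real_complexX (x : R) n : (x ^+ n)%:C = x%:C ^+ n :> R[i].
Proof. exact: rmorphXn. Qed.

Lemma conjM z w : Num.conj (z * w) = Num.conj z * Num.conj w.
Proof. exact: rmorphM. Qed.

Lemma conjB z w : Num.conj (z - w) = Num.conj z - Num.conj w.
Proof. exact: rmorphB. Qed.

Lemma real_complex1 : (1 : R)%:C = 1 :> R[i].
Proof. exact: rmorph1. Qed.

Lemma addc_conj z : z + Num.conj z = (complex.Re z + complex.Re z)%:C.
Proof. by case: z => a b; apply/eqP; rewrite eq_complex /=; apply/andP; split; apply/eqP; ring. Qed.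

Lemma cabs_sqr z : z * Num.conj z = (cabs z ^+ 2)%:C.
Proof. by rewrite -sqr_normc cabsE rmorphXn. Qed.

Lemma cabs_Re z : `|complex.Re z| <= cabs z.
Proof. by rewrite -lecR -cabsE normc_ge_Re. Qed.

Lemma Re_le_cabs z : complex.Re z <= cabs z.
Proof. exact: le_trans (ler_norm _) (cabs_Re z). Qed.

Lemma cabs_i : cabs ('i : R[i]) = 1.
Proof. by rewrite /cabs normc_def /= expr0n /= add0r expr1n sqrtr1. Qed.

Lemma ReD z w : complex.Re (z + w) = complex.Re z + complex.Re w.
Proof. by case: z w => [a b] [c d]. Qed.

Lemma ReMr z (x : R) : complex.Re (z * x%:C) = complex.Re z * x.
Proof. by case: z => [a b] /=; rewrite mulr0 subr0. Qed.

Lemma cabs2 z : cabs z ^+ 2 = complex.Re z ^+ 2 + complex.Im z ^+ 2.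
Proof. by apply: complexI; rewrite rmorphXn /= -cabsE -add_Re2_Im2. Qed.

Lemma cabs_Im z : `|complex.Im z| <= cabs z.
Proof.
rewrite -(@ler_pXn2r _ 2) ?nnegrE ?cabs_ge0 // cabs2 real_normK ?num_real //.
by rewrite lerDr sqr_ge0.
Qed.

Lemma cabs_le_ReIm z : cabs z <= `|complex.Re z| + `|complex.Im z|.
Proof.
rewrite -(@ler_pXn2r _ 2) ?nnegrE ?cabs_ge0 ?addr_ge0 // cabs2 sqrrD.
by rewrite !real_normK ?num_real // lerD2r lerDl mulrn_wge0 // mulr_ge0.
Qed.

Lemma ler_cabs_sum (I : Type) (r : seq I) (P : pred I) (F : I -> R[i]) :
  cabs (\sum_(i <- r | P i) F i) <= \sum_(i <- r | P i) cabs (F i).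
Proof.
elim/big_rec2: _ => [|i x y _ IH]; first by rewrite cabs0.
by apply: le_trans (cabsD _ _) _; rewrite lerD2l.
Qed.

(** Removes a constant factor: an inequality up to C that is inherited by all
powers of a function holds without C. *)
Lemma le_of_geometric_le (a b C : R) : 0 <= b ->
  (forall n, a ^+ n <= C * b ^+ n) -> a <= b.
Proof.
move=> b0 H; rewrite leNgt; apply/negP => ba.
have a0 : 0 < a by exact: le_lt_trans ba.
move: b0; rewrite le_eqVlt => /orP[/eqP b0|b0].
  by have := H 1%N; rewrite -b0 !expr1 mulr0 leNgt a0.
pose x := a / b - 1.
have x0 : 0 < x by rewrite subr_gt0 ltr_pdivlMr ?mul1r.
have ab : a / b = 1 + x by rewrite /x addrC subrK.
have bern n : 1 + n%:R * x <= (a / b) ^+ n.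
  elim: n => [|n IH]; first by rewrite mul0r addr0 expr0.
  rewrite exprS {1}ab; apply: le_trans (_ : (1 + x) * (1 + n%:R * x) <= _); last first.
    by rewrite ler_pM2l // addr_gt0.
  rewrite -natr1; have : 0 <= n%:R * x ^+ 2 by rewrite mulr_ge0 // sqr_ge0.
  by nra.
have Cb n : n%:R * x <= C.
  apply: le_trans (_ : (a / b) ^+ n <= _).
    by apply: le_trans (bern n); rewrite lerDr.
  by rewrite expr_div_n ler_pdivrMr ?exprn_gt0.
have C0 : 0 <= C by have := Cb 0%N; rewrite mul0r.
have := archi_boundP (divr_ge0 C0 (ltW x0)).
by rewrite ltr_pdivrMr // ltNge Cb.
Qed.
Lemma exists_pow2_gt (x : R) : 0 <= x -> exists j : nat, x < 2 ^+ j.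
Proof.
move=> x0; exists (Num.bound x); apply: lt_le_trans (archi_boundP x0) _.
by rewrite -natrX ler_nat ltnW // ltn_expl.
Qed.

End Modulus.

(** * Complex differentiability through slopes *)

Section ComplexDerivative.
Variable R : realType.
Implicit Types (z w : R[i]) (f g psi : R[i] -> R[i]).
Local Open Scope complex_scope.

Definition ccont f z := forall e : R, 0 < e ->
  exists2 d : R, 0 < d & forall w, cabs (w - z) < d -> cabs (f w - f z) < e.

(** Caratheodory's form of differentiability: with a slope psi continuous at z the
product, inverse and reflection rules become algebraic identities. *)
Definition cdiff f z := exists2 psi, ccont psi z &
  forall w, f w - f z = psi w * (w - z).

Lemma ccont_cst (c : R[i]) z : ccont (fun=> c) z.
Proof. by move=> e e0; exists 1 => // w _; rewrite subrr cabs0. Qed.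

Lemma ccont_id z : ccont id z.
Proof. by move=> e e0; exists e. Qed.

Lemma ccontD f g z : ccont f z -> ccont g z -> ccont (fun w => f w + g w) z.
Proof.
move=> hf hg e e0; have e20 : 0 < e / 2 by rewrite divr_gt0.
have [d1 d10 H1] := hf _ e20; have [d2 d20 H2] := hg _ e20.
exists (Num.min d1 d2); first by rewrite lt_min d10.
move=> w; rewrite lt_min => /andP[/H1 a /H2 b].
rewrite opprD addrACA; apply: le_lt_trans (cabsD _ _) _.
by rewrite [e]splitr ltrD.
Qed.

Lemma ccontM f g z : ccont f z -> ccont g z -> ccont (fun w => f w * g w) z.
Proof.
move=> hf hg e e0.
pose B := cabs (f z) + cabs (g z) + 1.
have B0 : 0 < B by rewrite ltr_wpDl // addr_ge0 // cabs_ge0.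
have e20 : 0 < Num.min 1 (e / (2 * B)) by rewrite lt_min ltr01 divr_gt0 // mulr_gt0.
have [d1 d10 H1] := hf _ e20; have [d2 d20 H2] := hg _ e20.
exists (Num.min d1 d2); first by rewrite lt_min d10.
move=> w; rewrite lt_min => /andP[/H1 + /H2].
rewrite !lt_min => /andP[a1 a2] /andP[b1 b2].
have -> : f w * g w - f z * g z = (f w - f z) * g w + f z * (g w - g z) by ring.
apply: le_lt_trans (cabsD _ _) _; rewrite !cabsM.
have gB : cabs (g w) <= B.
  have -> : g w = (g w - g z) + g z by rewrite subrK.
  apply: le_trans (cabsD _ _) _; rewrite /B.
  by have := cabs_ge0 (f z); lra.
have fB : cabs (f z) <= B by rewrite /B; have := cabs_ge0 (g z); lra.
have E : e = (e / (2 * B)) * B + B * (e / (2 * B)) by field; rewrite gt_eqF.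
rewrite {1}E; apply: ltr_leD.
  apply: le_lt_trans (ler_wpM2l (cabs_ge0 _) gB) _.
  by rewrite ltr_pM2r.
by apply: ler_pM; rewrite ?cabs_ge0 // ltW.
Qed.

Lemma ccontV f z : f z != 0 -> ccont f z -> ccont (fun w => (f w)^-1) z.
Proof.
move=> fz hf e e0; have a0 := cabs_gt0 fz; set a := cabs (f z) in a0.
have e20 : 0 < Num.min (a / 2) (e * (a * (a / 2))).
  by rewrite lt_min divr_gt0 // !mulr_gt0 // divr_gt0.
have [d d0 H] := hf _ e20; exists d => // w /H; rewrite lt_min => /andP[h1 h2].
have fw : a / 2 < cabs (f w).
  have := cabsD (f w) (f z - f w); rewrite addrC subrK cabsB -/a.
  by move=> h; lra.
have fw0 : f w != 0.
  by apply/negP => /eqP fw0; move: fw; rewrite fw0 cabs0; lra.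
have -> : (f w)^-1 - (f z)^-1 = (f z - f w) / (f z * f w) by field; rewrite fw0 fz.
rewrite cabsM cabsV cabsM -/a cabsB ltr_pdivrMr; last by rewrite mulr_gt0 // cabs_gt0.
apply: lt_le_trans h2 _; rewrite ler_pM2l // ler_pM2l //; exact: ltW.
Qed.

Lemma cdiff_cont f z : cdiff f z -> ccont f z.
Proof.
move=> [psi hp E].
have : ccont (fun w => f z + psi w * (w + - z)) z.
  apply: ccontD; first exact: ccont_cst.
  apply: ccontM => //; apply: ccontD; [exact: ccont_id|exact: ccont_cst].
move=> h e e0; have [d d0 H] := h e e0; exists d => // w /H.
by rewrite -!E subrr addr0; congr (cabs _ < _); ring.
Qed.

Lemma cdiff_ext f g z : (forall w, f w = g w) -> cdiff f z -> cdiff g z.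
Proof. by move=> /funext ->. Qed.

Lemma cdiff_cst (c : R[i]) z : cdiff (fun=> c) z.
Proof. by exists (fun=> 0); [exact: ccont_cst|move=> w; rewrite subrr mul0r]. Qed.

Lemma cdiff_id z : cdiff id z.
Proof. by exists (fun=> 1); [exact: ccont_cst|move=> w; rewrite mul1r]. Qed.

Lemma cdiffD f g z : cdiff f z -> cdiff g z -> cdiff (fun w => f w + g w) z.
Proof.
move=> [p hp Ep] [q hq Eq]; exists (fun w => p w + q w); first exact: ccontD.
by move=> w; rewrite opprD addrACA Ep Eq mulrDl.
Qed.

Lemma cdiffM f g z : cdiff f z -> cdiff g z -> cdiff (fun w => f w * g w) z.
Proof.
move=> hf hg; have := hf; have := hg => -[q hq Eq] [p hp Ep].
exists (fun w => p w * g w + f z * q w).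
  apply: ccontD; apply: ccontM => //; [exact: cdiff_cont|exact: ccont_cst].
move=> w; rewrite mulrDl -mulrA (mulrC (g w)) mulrA -Ep -mulrA -Eq; ring.
Qed.

Lemma cdiffX f n z : cdiff f z -> cdiff (fun w => f w ^+ n) z.
Proof.
move=> hf; elim: n => [|n IH]; first exact: cdiff_cst.
by apply: (@cdiff_ext (fun w => f w * f w ^+ n)) => [w|]; [rewrite exprS|exact: cdiffM].
Qed.

(** The slope of 1/f is - psi / (f(w) f(z)); where f vanishes the inverse is 0 by
convention, and the slope has to be corrected there, away from z. *)
Lemma cdiffV f z : f z != 0 -> cdiff f z -> cdiff (fun w => (f w)^-1) z.
Proof.
move=> fz hf; have := hf => -[p hp Ep].
exists (fun w => if f w == 0 then - (f z)^-1 / (w - z) else - p w * (f w)^-1 * (f z)^-1).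
  have : ccont (fun w => (-1) * p w * (f w)^-1 * (f z)^-1) z.
    apply: ccontM; last exact: ccont_cst.
    apply: ccontM; last by apply: ccontV => //; exact: cdiff_cont.
    by apply: ccontM => //; exact: ccont_cst.
  move=> h e e0; have [d1 d10 H1] := h e e0.
  have [d2 d20 H2] := cdiff_cont hf (cabs_gt0 fz).
  exists (Num.min d1 d2); first by rewrite lt_min d10.
  move=> w; rewrite lt_min => /andP[/H1 a /H2 b].
  rewrite (negbTE fz); case: eqP => [fw|_].
    by move: b; rewrite fw sub0r cabsN ltxx.
  by move: a; rewrite !mulN1r.
move=> w; case: eqP => [fw|/eqP fw].
  have wz : w != z by apply: contra_neq fz => <-.
  rewrite fw invr0 sub0r.
  by rewrite mulfVK // subr_eq0.
have -> : - p w / f w / f z * (w - z) = - (p w * (w - z)) / f w / f z by ring.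
by rewrite -Ep; field; rewrite fz fw.
Qed.

Lemma cdiff_approx f z : cdiff f z -> exists l : R[i], forall e : R, 0 < e ->
  exists2 d : R, 0 < d & forall w, cabs (w - z) < d ->
    cabs (f w - (f z + l * (w - z))) <= e * cabs (w - z).
Proof.
move=> [p hp Ep]; exists (p z) => e e0; have [d d0 H] := hp e e0.
exists d => // w /H h; have -> : f w - (f z + p z * (w - z)) = (p w - p z) * (w - z).
  by rewrite opprD addrA Ep; ring.
by rewrite cabsM ler_wpM2r ?cabs_ge0 // ltW.
Qed.

Definition reflect_at (c w : R[i]) : R[i] := Num.conj (w - c) + c.

Lemma reflect_atB c w z : reflect_at c w - reflect_at c z = Num.conj (w - z).
Proof. by rewrite /reflect_at !rmorphB; ring. Qed.

Lemma cabs_reflect_at c w : cabs (reflect_at c w - c) = cabs (w - c).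
Proof. by rewrite /reflect_at addrK cabsJ. Qed.

(** Conjugation is antiholomorphic; conjugating both the variable and the value
gives back a holomorphic function.  On the line of reflection the product of
f with its reflection is |f|^2, a nonnegative function. *)
Lemma cdiff_reflect f c z :
  cdiff f (reflect_at c z) -> cdiff (fun w => Num.conj (f (reflect_at c w))) z.
Proof.
move=> [p hp Ep]; exists (fun w => Num.conj (p (reflect_at c w))).
  move=> e e0; have [d d0 H] := hp e e0; exists d => // w wz.
  by rewrite -rmorphB cabsJ; apply: H; rewrite reflect_atB cabsJ.
by move=> w; rewrite -rmorphB Ep reflect_atB rmorphM /= conjCK.
Qed.

End ComplexDerivative.

(** * Goursat's lemma for trapezoid sums *)

Section Goursat.
Variable R : realType.
Implicit Types (z w h : R[i]) (f g F G : R[i] -> R[i]) (s d M m : R).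
Local Open Scope complex_scope.

(** The sum of the trapezoid rule with 2^k equal steps along the segment from z to
z + h.  Recursion on halves makes the sums at level k + 1 exactly additive over
the two halves at level k, so that no integral is needed. *)
Fixpoint trap (k : nat) (F : R[i] -> R[i]) (z h : R[i]) : R[i] :=
  if k is k'.+1 then trap k' F z (h / 2) + trap k' F (z + h / 2) (h / 2)
  else (F z + F (z + h)) / 2 * h.

Definition in_seg z h w := exists2 t : R, 0 <= t <= 1 & w = z + t%:C * h.

Lemma real_half : (2^-1 : R)%:C = 2^-1 :> R[i].
Proof. by rewrite fmorphV rmorphMn. Qed.

Lemma in_seg_halfl z h w : in_seg z (h / 2) w -> in_seg z h w.
Proof.
move=> [t /andP[t0 t1] ->]; exists (t / 2); first by apply/andP; split; lra.
by rewrite rmorphM /= real_half; ring.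
Qed.

Lemma in_seg_halfr z h w : in_seg (z + h / 2) (h / 2) w -> in_seg z h w.
Proof.
move=> [t /andP[t0 t1] ->]; exists ((t + 1)/ 2); first by apply/andP; split; lra.
by rewrite rmorphM rmorphD /= real_half; ring.
Qed.

Lemma in_seg_l z h : in_seg z h z.
Proof. by exists 0; rewrite ?lexx ?ler01 // mul0r addr0. Qed.

Lemma in_seg_r z h : in_seg z h (z + h).
Proof. by exists 1; rewrite ?lexx ?ler01 // mul1r. Qed.

Lemma cabs_half h : cabs (h / 2) = cabs h / 2.
Proof. by rewrite cabsM -real_half cabs_real gtr0_norm // invr_gt0. Qed.

Lemma trap_bound k F z h M : (forall w, in_seg z h w -> cabs (F w) <= M) ->
  cabs (trap k F z h) <= M * cabs h.
Proof.
elim: k z h => [|k IH] z h H /=.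
  rewrite cabsM ler_wpM2r ?cabs_ge0 // cabs_half.
  have := cabsD (F z) (F (z + h)).
  have := H _ (in_seg_l z h); have := H _ (in_seg_r z h); lra.
apply: le_trans (cabsD _ _) _; have := cabs_half h => E.
have h1 := IH z (h / 2) (fun w hw => H w (in_seg_halfl hw)).
have h2 := IH (z + h / 2) (h / 2) (fun w hw => H w (in_seg_halfr hw)).
by rewrite E in h1 h2; lra.
Qed.

Lemma trap_Re k F z (s : R) m : 0 <= s ->
  (forall w, in_seg z s%:C w -> m <= complex.Re (F w)) ->
  m * s <= complex.Re (trap k F z s%:C).
Proof.
elim: k z s => [|k IH] z s s0 H /=.
  rewrite ReMr ler_wpM2r // -real_half ReMr ReD.
  have := H _ (in_seg_l z _); have := H _ (in_seg_r z _); lra.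
have E : s%:C / 2 = (s / 2)%:C by rewrite rmorphM /= real_half.
rewrite E ReD.
have s20 : 0 <= s / 2 by lra.
have h1 := IH z (s / 2) s20; have h2 := IH (z + (s / 2)%:C) (s / 2) s20.
have h3 : m * (s / 2) <= complex.Re (trap k F z (s / 2)%:C).
  by apply: h1 => w hw; apply: H; apply: in_seg_halfl; rewrite E.
have h4 : m * (s / 2) <= complex.Re (trap k F (z + (s / 2)%:C) (s / 2)%:C).
  by apply: h2 => w hw; apply: H; apply: in_seg_halfr; rewrite E.
by apply: le_trans (lerD h3 h4); rewrite -mulrDr -splitr.
Qed.

Lemma trapD k F G z h :
  trap k (fun w => F w + G w) z h = trap k F z h + trap k G z h.
Proof. by elim: k z h => [|k IH] z h /=; [ring|rewrite !IH; ring]. Qed.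

(** The trapezoid rule is exact on affine functions, hence closed sums of f only
see the remainder of its affine approximation. *)
Lemma trap_affine k (a b : R[i]) z h :
  trap k (fun w => a + b * w) z h = (a + b * z + b * h / 2) * h.
Proof.
by elim: k z h => [|k IH] z h /=; [|rewrite !IH]; field.
Qed.

Definition boundary_sum k F z (s : R) : R[i] :=
  trap k F z s%:C + trap k F (z + s%:C) ('i * s%:C)
  - trap k F (z + 'i * s%:C) s%:C - trap k F z ('i * s%:C).

(** The sums along the inner edges of the four quadrants cancel, since adjacent
quadrants run through the same nodes in opposite directions. *)
Lemma boundary_sumS k F z s : boundary_sum k.+1 F z s =
  boundary_sum k F z (s / 2) + boundary_sum k F (z + (s / 2)%:C) (s / 2)
  + boundary_sum k F (z + 'i * (s / 2)%:C) (s / 2)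
  + boundary_sum k F (z + (s / 2)%:C + 'i * (s / 2)%:C) (s / 2).
Proof.
rewrite /boundary_sum /=.
have -> : s%:C / 2 = (s / 2)%:C by rewrite rmorphM /= real_half.
have -> : 'i * s%:C / 2 = 'i * (s / 2)%:C by rewrite rmorphM /= real_half; ring.
have -> : z + s%:C = z + (s / 2)%:C + (s / 2)%:C.
  by rewrite rmorphM /= real_half; field.
have -> : z + 'i * s%:C = z + 'i * (s / 2)%:C + 'i * (s / 2)%:C.
  by rewrite rmorphM /= real_half; field.
move: (s / 2)%:C ('i * (s / 2)%:C) => a b.
have -> : z + a + b + a = z + a + a + b by ring.
have -> : z + a + b + b = z + b + b + a by ring.
have -> : z + b + a = z + a + b by ring.
ring.
Qed.

Lemma boundary_sumD k F G z s :
  boundary_sum k (fun w => F w + G w) z s = boundary_sum k F z s + boundary_sum k G z s.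
Proof. by rewrite /boundary_sum !trapD; ring. Qed.

Lemma boundary_sum_affine k (a b : R[i]) z s :
  boundary_sum k (fun w => a + b * w) z s = 0.
Proof. by rewrite /boundary_sum !trap_affine; field. Qed.

Lemma cabs_is (s : R) : 0 <= s -> cabs ('i * s%:C) = s.
Proof. by move=> s0; rewrite cabsM cabs_i mul1r cabs_real ger0_norm. Qed.

Definition in_square z (s : R) w := exists a b : R,
  [/\ 0 <= a <= s, 0 <= b <= s & w = z + a%:C + 'i * b%:C].

Lemma boundary_sum_bound k F z s M : 0 <= s ->
  (forall w, in_square z s w -> cabs (F w) <= M) ->
  cabs (boundary_sum k F z s) <= 4 * M * s.
Proof.
move=> s0 H; rewrite /boundary_sum.
have ts t : 0 <= t <= 1 -> 0 <= t * s <= s.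
  by move=> /andP[t0 t1]; rewrite mulr_ge0 //= -{2}(mul1r s) ler_wpM2r.
have z0s : 0 <= (0:R) <= s by rewrite lexx.
have sss : 0 <= s <= s by rewrite s0 lexx.
have b1 : cabs (trap k F z s%:C) <= M * s.
  rewrite -{2}[s]ger0_norm // -cabs_real; apply: trap_bound => w [t /ts tt ->].
  by apply: H; exists (t * s), 0; split => //; rewrite rmorphM; ring.
have b2 : cabs (trap k F (z + s%:C) ('i * s%:C)) <= M * s.
  rewrite -{3}[s]cabs_is //; apply: trap_bound => w [t /ts tt ->].
  by apply: H; exists s, (t * s); split => //; rewrite rmorphM; ring.
have b3 : cabs (trap k F (z + 'i * s%:C) s%:C) <= M * s.
  rewrite -{3}[s]ger0_norm // -cabs_real; apply: trap_bound => w [t /ts tt ->].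
  by apply: H; exists (t * s), s; split => //; rewrite rmorphM; ring.
have b4 : cabs (trap k F z ('i * s%:C)) <= M * s.
  rewrite -{2}[s]cabs_is //; apply: trap_bound => w [t /ts tt ->].
  by apply: H; exists 0, (t * s); split => //; rewrite rmorphM; ring.
apply: le_trans (cabsD _ _) _; rewrite cabsN.
have := cabsD (trap k F z s%:C + trap k F (z + s%:C) ('i * s%:C))
  (- trap k F (z + 'i * s%:C) s%:C); rewrite cabsN.
have := cabsD (trap k F z s%:C) (trap k F (z + s%:C) ('i * s%:C)).
lra.
Qed.

(** The bound is proportional to the area, which is what makes it pass from the
quadrants of a square to the square. *)
Definition small_sums (F : R[i] -> R[i]) (d : R) (z : R[i]) (s : R) :=
  exists K, forall k, (K <= k)%N -> cabs (boundary_sum k F z s) <= d * s ^+ 2.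

Definition quadrant z (s : R) (i j : bool) : R[i] :=
  z + (if i then (s / 2)%:C else 0) + (if j then 'i * (s / 2)%:C else 0).

Lemma small_sums_quadrants F d z s :
  (forall i j, small_sums F d (quadrant z s i j) (s / 2)) -> small_sums F d z s.
Proof.
move=> H; have [K1 H1] := H false false; have [K2 H2] := H true false.
have [K3 H3] := H false true; have [K4 H4] := H true true.
exists (maxn (maxn K1 K2) (maxn K3 K4)).+1 => -[//|k].
rewrite ltnS !geq_max => /andP[/andP[k1 k2] /andP[k3 k4]].
have := H1 _ k1; have := H2 _ k2; have := H3 _ k3; have := H4 _ k4.
rewrite boundary_sumS /quadrant !addr0 => h4 h3 h2 h1.
apply: le_trans (cabsD _ _) _; apply: le_trans (lerD (cabsD _ _) (lexx _)) _.
apply: le_trans (lerD (lerD (cabsD _ _) (lexx _)) (lexx _)) _.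
apply: le_trans (lerD (lerD (lerD h1 h2) h3) h4) _.
by rewrite le_eqVlt; apply/orP; left; apply/eqP; field.
Qed.

Lemma nested_intervals (a s : nat -> R) : (forall j, 0 <= s j) ->
  (forall j, a j <= a j.+1) -> (forall j, a j.+1 + s j.+1 <= a j + s j) ->
  exists x, forall j, a j <= x <= a j + s j.
Proof.
move=> s0 au bd.
have A i j : (i <= j)%N -> a i <= a j.
  by move=> ij; rewrite -(subnK ij); elim: (j - i)%N => // k IH; exact: le_trans (au _).
have B i j : (i <= j)%N -> a j + s j <= a i + s i.
  by move=> ij; rewrite -(subnK ij); elim: (j - i)%N => // k IH; exact: le_trans (bd _) IH.
have AB i j : a i <= a j + s j.
  case: (leqP i j) => ij; first by apply: le_trans (A _ _ ij) _; rewrite lerDl.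
  by apply: le_trans (B _ _ (ltnW ij)); rewrite lerDl.
exists (sup (range a)) => j; apply/andP; split.
  by apply: ub_le_sup; [exists (a 0%N + s 0%N) => _ [i _ <-]|exists j].
by apply: ge_sup; [exists (a 0%N), 0%N|move=> _ [i _ <-]].
Qed.

Lemma in_squareP z s w : in_square z s w <->
  0 <= complex.Re w - complex.Re z <= s /\ 0 <= complex.Im w - complex.Im z <= s.
Proof.
split=> [[a [b [ha hb ->]]]|[ha hb]].
  by case: z => x y /=; rewrite !mul0r !mul1r !subr0 ?addr0 ?add0r; split;
     [rewrite addrC addKr|rewrite addrC addKr].
exists (complex.Re w - complex.Re z), (complex.Im w - complex.Im z); split => //.
case: w z {ha hb} => [u v] [x y]; apply/eqP; rewrite eq_complex /=; apply/andP.
by split; apply/eqP; ring.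
Qed.

Lemma in_square_dist z s w w' : in_square z s w -> in_square z s w' ->
  cabs (w - w') <= 2 * s.
Proof.
move=> /in_squareP[/andP[a1 a2] /andP[b1 b2]] /in_squareP[/andP[c1 c2] /andP[d1 d2]].
apply: le_trans (cabs_le_ReIm _) _.
have -> : 2 * s = s + s by ring.
apply: lerD; rewrite ler_norml; case: w w' a1 a2 b1 b2 c1 c2 d1 d2 => [u v] [x y] /=; lra.
Qed.

(** If the sums along the square are not eventually below d s^2, the same holds for
one of its quadrants, then for one of the quadrants of that one, and so on.
These squares shrink to a point, where the affine approximation of F gives the
contradiction. *)
Theorem goursat F z s : 0 < s -> (forall w, in_square z s w -> cdiff F w) ->
  forall d, 0 < d -> small_sums F d z s.
Proof.
move=> s0 HF d d0; apply: contrapT => nsmall.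
have /choice[q Hq] : forall p : R[i] * R, exists ij : bool * bool,
    ~ small_sums F d p.1 p.2 ->
    ~ small_sums F d (quadrant p.1 p.2 ij.1 ij.2) (p.2 / 2).
  move=> p; have [sp|nsp] := pselect (small_sums F d p.1 p.2); first by exists (true, true).
  apply: contrapT => H; apply: nsp; apply: small_sums_quadrants => i j.
  by apply: contrapT => nij; apply: H; exists (i, j).
pose step p := (quadrant p.1 p.2 (q p).1 (q p).2, p.2 / 2) : R[i] * R.
pose sq j := iter j step (z, s).
have sqS j : sq j.+1 = step (sq j) by [].
have nsq j : ~ small_sums F d (sq j).1 (sq j).2.
  by elim: j => [//|j IH]; rewrite sqS; exact: Hq.
have side j : (sq j).2 = s / 2 ^+ j.
  by elim: j => [|j IH]; rewrite ?divr1 // sqS /= IH exprS; field; rewrite expf_neq0.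
have sj0 j : 0 <= (sq j).2 by rewrite side divr_ge0 ?exprn_ge0 // ltW.
have nest j : [/\ complex.Re (sq j).1 <= complex.Re (sq j.+1).1,
    complex.Re (sq j.+1).1 + (sq j.+1).2 <= complex.Re (sq j).1 + (sq j).2,
    complex.Im (sq j).1 <= complex.Im (sq j.+1).1 &
    complex.Im (sq j.+1).1 + (sq j.+1).2 <= complex.Im (sq j).1 + (sq j).2].
  have := sj0 j; rewrite sqS /step /quadrant.
  by case: (q _) => -[] [] /=; case: (sq j) => -[u v] r /= r0; split; lra.
have [x Hx] : exists x, forall j,
    complex.Re (sq j).1 <= x <= complex.Re (sq j).1 + (sq j).2.
  by apply: nested_intervals => // j; case: (nest j).
have [y Hy] : exists y, forall j,
    complex.Im (sq j).1 <= y <= complex.Im (sq j).1 + (sq j).2.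
  by apply: nested_intervals => // j; case: (nest j).
have ins j : in_square (sq j).1 (sq j).2 (x +i* y).
  by apply/in_squareP => /=; have := Hx j; have := Hy j => /andP[? ?] /andP[? ?]; split; lra.
have [l Hl] := cdiff_approx (HF _ (ins 0%N)).
have d80 : 0 < d / 8 by rewrite divr_gt0.
have [r r0 Hr] := Hl _ d80.
have [j Xj] : exists j : nat, 2 * s / r < 2 ^+ j.
  by apply: exists_pow2_gt; rewrite divr_ge0 ?mulr_ge0 // ltW.
have jr : 2 * (sq j).2 < r.
  have j2 : (0 : R) < 2 ^+ j by rewrite exprn_gt0.
  rewrite side mulrA ltr_pdivrMr //; move: Xj; rewrite ltr_pdivrMr //.
  by rewrite (mulrC (2 ^+ j)).
apply: (nsq j); exists 0%N => k _.
set c := (sq j).1 in ins *; set t := (sq j).2 in jr *.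
have t0 : 0 <= t by exact: sj0.
pose G w := F w - (F (x +i* y) + l * (w - (x +i* y))).
have -> : F = fun w => G w + ((F (x +i* y) - l * (x +i* y)) + l * w).
  by apply/funext => w; rewrite /G; ring.
rewrite boundary_sumD boundary_sum_affine addr0.
apply: le_trans (_ : 4 * (d / 8 * (2 * t)) * t <= _); last first.
  by rewrite le_eqVlt; apply/orP; left; apply/eqP; field.
apply: boundary_sum_bound => // w wt.
have h := in_square_dist wt (ins j).
apply: le_trans (Hr _ (le_lt_trans h jr)) _.
by rewrite ler_wpM2l // ltW.
Qed.

End Goursat.

(** * A local maximum principle by reflection *)

Section LocalMax.
Variable R : realType.
Implicit Types (z w h : R[i]) (f g F p : R[i] -> R[i]) (s d M m r : R).
Local Open Scope complex_scope.

(** Keeps only the initial piece of the segment, of relative length 2^-j, on which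
the lower bound m is available. *)
Lemma trap_initial j k F z s m : 0 <= s ->
  (forall w, in_seg z s%:C w -> 0 <= complex.Re (F w)) ->
  (forall w, in_seg z (s / 2 ^+ j)%:C w -> m <= complex.Re (F w)) ->
  m * (s / 2 ^+ j) <= complex.Re (trap (k + j) F z s%:C).
Proof.
elim: j s => [|j IH] s s0 H0 Hm; first by move: Hm; rewrite expr0 divr1 addn0; exact: trap_Re.
have E : s%:C / 2 = (s / 2)%:C by rewrite rmorphM /= real_half.
have s20 : 0 <= s / 2 by lra.
rewrite addnS /= E ReD; apply: ler_wpDr.
  rewrite -[0](mul0r (s / 2)); apply: trap_Re => // w hw.
  by apply: H0; apply: in_seg_halfr; rewrite E.
have E2 : s / 2 ^+ j.+1 = s / 2 / 2 ^+ j by rewrite exprS invfM mulrA.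
rewrite E2; apply: IH => // w hw.
  by apply: H0; apply: in_seg_halfl; rewrite E.
by apply: Hm; rewrite E2.
Qed.

Lemma le_cabs_of_Re z s : s <= `|complex.Re z| -> s <= cabs z.
Proof. by move=> h; apply: le_trans h (cabs_Re z). Qed.

Lemma le_cabs_of_Im z s : s <= `|complex.Im z| -> s <= cabs z.
Proof. by move=> h; apply: le_trans h (cabs_Im z). Qed.

(** The function F = (p(w) conj(p(w')))^k, with w' the mirror image of w in the
horizontal line through z0, is holomorphic, equals |p|^(2k) on that line and is
at most M^(2k) on the three other sides of a square whose lower side is centred
at z0.  By Goursat's lemma the sum of |p|^(2k) along the lower side is at most
3 s M^(2k) in the limit; if |p(z0)| > M it would exceed a fixed multiple of
r^k with r > M^2, which is impossible for large k. *)
Lemma local_max p z0 s M : 0 < s ->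
  (forall w, cabs (w - z0) <= 2 * s -> cdiff p w) ->
  (forall w, s / 2 <= cabs (w - z0) <= 2 * s -> cabs (p w) <= M) ->
  cabs (p z0) <= M.
Proof.
move=> s0 hp hM.
pose q w := p w * Num.conj (p (reflect_at z0 w)).
pose z := z0 - (s / 2)%:C.
have M0 : 0 <= M.
  apply: le_trans (cabs_ge0 (p (z0 + s%:C))) _; apply: hM.
  by rewrite addrC addKr cabs_real ger0_norm; lra.
have qdiff w : cabs (w - z0) <= 2 * s -> cdiff q w.
  move=> h; apply: cdiffM; first exact: hp.
  by apply: cdiff_reflect; apply: hp; rewrite cabs_reflect_at.
have qM w : s / 2 <= cabs (w - z0) <= 2 * s -> cabs (q w) <= M ^+ 2.
  move=> h; rewrite cabsM cabsJ expr2; apply: ler_pM; rewrite ?cabs_ge0 //.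
    exact: hM.
  by apply: hM; rewrite cabs_reflect_at.
have qreal (t : R) : q (z0 + t%:C) = (cabs (p (z0 + t%:C)) ^+ 2)%:C.
  have E : reflect_at z0 (z0 + t%:C) = z0 + t%:C.
    have e : z0 + t%:C - z0 = t%:C by ring.
    by rewrite /reflect_at e conj_real addrC.
  by rewrite /q E cabs_sqr.
have sqd w : in_square z s w -> cabs (w - z0) <= 2 * s.
  move=> [a [b [/andP[a0 a1] /andP[b0 b1] ->]]].
  have -> : z + a%:C + 'i * b%:C - z0 = (a - s / 2)%:C + 'i * b%:C.
    by rewrite /z rmorphB /=; ring.
  apply: le_trans (cabsD _ _) _; rewrite cabs_real cabs_is //.
  have : `|a - s / 2| <= s / 2 by rewrite ler_norml; apply/andP; split; lra.
  lra.
have seg01 (t : R) : 0 <= t <= 1 -> 0 <= t * s <= s.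
  by move=> /andP[t0 t1]; rewrite mulr_ge0 //= ?(ltW s0) // -{2}(mul1r s) ler_pM2r.
(* The three sides other than the lower one. *)
have side_bound n k (v h : R[i]) : cabs h = s ->
    (forall w, in_seg v h w -> s / 2 <= cabs (w - z0) <= 2 * s) ->
    cabs (trap k (fun w => q w ^+ n) v h) <= (M ^+ 2) ^+ n * s.
  move=> hs H; rewrite -hs; apply: trap_bound => w /H hw; rewrite cabsX.
  by rewrite lerXn2r ?nnegrE ?cabs_ge0 ?sqr_ge0 // qM.
have key r : r < cabs (p z0) ^+ 2 -> 0 <= r -> r <= M ^+ 2.
  move=> rp r0.
  have pc : ccont p z0 by apply/cdiff_cont/hp; rewrite subrr cabs0; lra.
  have [d0 d00 Hd] : exists2 d0 : R, 0 < d0 &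
      forall w, cabs (w - z0) < d0 -> r <= cabs (p w) ^+ 2.
    have e0 : 0 < cabs (p z0) - Num.sqrt r.
      by rewrite subr_gt0 -[X in _ < X]ger0_norm ?cabs_ge0 // -sqrtr_sqr ltr_sqrt // (le_lt_trans r0).
    have [d0 d00 Hd] := pc _ e0; exists d0 => // w /Hd h.
    rewrite -(sqr_sqrtr r0) lerXn2r ?nnegrE ?sqrtr_ge0 ?cabs_ge0 //.
    have := cabsD (p w) (p z0 - p w); rewrite addrC subrK cabsB; lra.
  have [j Xj] : exists j : nat, s / d0 < 2 ^+ j.
    by apply: exists_pow2_gt; rewrite divr_ge0 // ltW.
  have j2 : (0 : R) < 2 ^+ j by rewrite exprn_gt0.
  have s2d : s / 2 / 2 ^+ j < d0.
    by rewrite ltr_pdivrMr //; move: Xj; rewrite ltr_pdivrMr // (mulrC (2 ^+ j)); lra.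
  set c := s / 2 / 2 ^+ j in s2d.
  have c0 : 0 < c by rewrite /c !divr_gt0.
  (* c is the length of the piece of the lower side on which |p|^2 >= r. *)
  apply: (@le_of_geometric_le _ _ _ (3 * s / c)); first exact: sqr_ge0.
  move=> n; rewrite mulrAC ler_pdivlMr //.
  apply/ler_addgt0Pr => e1 e10.
  have e2 : 0 < e1 / s ^+ 2 by rewrite divr_gt0 // exprn_gt0.
  have [K HK] : small_sums (fun w => q w ^+ n) (e1 / s ^+ 2) z s.
    by apply: goursat => // w /sqd hw; apply: cdiffX; exact: qdiff.
  have := HK (K + j).+1 (leqW (leq_addr _ _)).
  rewrite divfK ?expf_neq0 ?gt_eqF // => HI.
  set F := fun w => q w ^+ n in HI.
  have Fre (t : R) : complex.Re (F (z0 + t%:C)) = (cabs (p (z0 + t%:C)) ^+ 2) ^+ n.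
    by rewrite /F qreal -rmorphXn.
  have bottom : r ^+ n * c <= complex.Re (trap (K + j).+1 F z s%:C).
    have E : s%:C / 2 = (s / 2)%:C by rewrite rmorphM /= real_half.
    have Ez : z + (s / 2)%:C = z0 by rewrite /z subrK.
    have s20 : 0 <= s / 2 by lra.
    rewrite /= E Ez ReD; apply: ler_wpDl.
      rewrite -[0](mul0r (s / 2)); apply: trap_Re => // w [t _ ->].
      have -> : z + t%:C * (s / 2)%:C = z0 + (t * (s / 2) - s / 2)%:C.
        by rewrite /z rmorphB rmorphM /=; ring.
      by rewrite Fre exprn_ge0 // sqr_ge0.
    apply: trap_initial => // w [t /andP[t0 t1] ->]; rewrite -rmorphM Fre.
      by rewrite exprn_ge0 // sqr_ge0.
    apply: lerXn2r; rewrite ?nnegrE ?sqr_ge0 //.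
    apply: Hd; rewrite addrC addKr cabs_real ger0_norm; last by rewrite mulr_ge0 // ltW.
    by apply: le_lt_trans s2d; rewrite ler_piMl // ltW.
  have cs : cabs (s%:C) = s by rewrite cabs_real ger0_norm // ltW.
  have cis : cabs ('i * s%:C) = s by rewrite cabs_is // ltW.
  have right_edge : cabs (trap (K + j).+1 F (z + s%:C) ('i * s%:C)) <= (M ^+ 2) ^+ n * s.
    apply: side_bound => // w [t /seg01 ht ->]; apply/andP; split.
      apply: le_cabs_of_Re; rewrite /z; case: (z0) => u v /=.
      by rewrite !(mul0r, mul1r, mulr0, subr0, addr0); rewrite ger0_norm; lra.
    by apply: sqd; exists s, (t * s); split; [rewrite (ltW s0) lexx|done|rewrite rmorphM; ring].
  have top_edge : cabs (trap (K + j).+1 F (z + 'i * s%:C) s%:C) <= (M ^+ 2) ^+ n * s.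
    apply: side_bound => // w [t /seg01 ht ->]; apply/andP; split.
      apply: le_cabs_of_Im; rewrite /z; case: (z0) => u v /=.
      by rewrite !(mul0r, mul1r, mulr0, subr0, addr0, oppr0); rewrite ger0_norm; lra.
    by apply: sqd; exists (t * s), s; split; [done|rewrite (ltW s0) lexx|rewrite rmorphM; ring].
  have left_edge : cabs (trap (K + j).+1 F z ('i * s%:C)) <= (M ^+ 2) ^+ n * s.
    apply: side_bound => // w [t /seg01 ht ->]; apply/andP; split.
      apply: le_cabs_of_Re; rewrite /z; case: (z0) => u v /=.
      by rewrite !(mul0r, mul1r, mulr0, subr0, addr0); rewrite ler0_norm; lra.
    by apply: sqd; exists 0, (t * s); split; [rewrite (ltW s0) lexx|done|rewrite rmorphM; ring].
  apply: le_trans bottom _; apply: le_trans (Re_le_cabs _) _.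
  have -> : trap (K + j).+1 F z s%:C = boundary_sum (K + j).+1 F z s
     - trap (K + j).+1 F (z + s%:C) ('i * s%:C) + trap (K + j).+1 F (z + 'i * s%:C) s%:C
     + trap (K + j).+1 F z ('i * s%:C).
    by rewrite /boundary_sum; ring.
  apply: le_trans (cabsD _ _) _; apply: le_trans (lerD (cabsD _ _) (lexx _)) _.
  apply: le_trans (lerD (lerD (cabsD _ _) (lexx _)) (lexx _)) _; rewrite cabsN.
  apply: le_trans (lerD (lerD (lerD HI right_edge) top_edge) left_edge) _.
  by rewrite le_eqVlt; apply/orP; left; apply/eqP; ring.
have : cabs (p z0) ^+ 2 <= M ^+ 2.
  rewrite leNgt; apply/negP => h.
  have := key ((cabs (p z0) ^+ 2 + M ^+ 2) / 2).
  have := sqr_ge0 M; lra.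
by rewrite ler_pXn2r ?nnegrE ?cabs_ge0.
Qed.
End LocalMax.

(** * The Hermitian product and the Euclidean norm *)

Section Hermitian.
Variables (R : realType) (n : nat).
Implicit Types (z w a b : 'rV[R[i]]_n) (c : R[i]) (x r : R).
Local Open Scope complex_scope.

Definition dotc z w : R[i] := \sum_j z ord0 j * Num.conj (w ord0 j).

Lemma dotcDl z w a : dotc (z + w) a = dotc z a + dotc w a.
Proof. by rewrite -big_split; apply: eq_bigr => j _; rewrite mxE mulrDl. Qed.

Lemma dotcZl c z a : dotc (c *: z) a = c * dotc z a.
Proof. by rewrite mulr_sumr; apply: eq_bigr => j _; rewrite mxE mulrA. Qed.

Lemma dotcC z a : dotc z a = Num.conj (dotc a z).
Proof.
by rewrite rmorph_sum; apply: eq_bigr => j _; rewrite rmorphM /= conjCK mulrC.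
Qed.

Lemma dotcDr z w a : dotc a (z + w) = dotc a z + dotc a w.
Proof. by rewrite dotcC dotcDl rmorphD /= -!dotcC. Qed.

Lemma dotcZr c z a : dotc a (c *: z) = Num.conj c * dotc a z.
Proof. by rewrite dotcC dotcZl rmorphM /= -dotcC. Qed.

Lemma dotcNl z a : dotc (- z) a = - dotc z a.
Proof. by rewrite -scaleN1r dotcZl mulN1r. Qed.

Lemma dotcNr z a : dotc a (- z) = - dotc a z.
Proof. by rewrite dotcC dotcNl rmorphN /= -dotcC. Qed.

Lemma dotc0l a : dotc 0 a = 0.
Proof. by rewrite -(scale0r 0) dotcZl mul0r. Qed.

Lemma sum_sqr_ge0 z : 0 <= \sum_(j < n) cabs (z ord0 j) ^+ 2.
Proof. by apply: sumr_ge0 => j _; exact: sqr_ge0. Qed.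

Lemma enorm_ge0 z : 0 <= enorm z.
Proof. exact: sqrtr_ge0. Qed.

Lemma enorm_sqr z : enorm z ^+ 2 = \sum_(j < n) cabs (z ord0 j) ^+ 2.
Proof. by rewrite sqr_sqrtr // sum_sqr_ge0. Qed.

Lemma dotc_self z : dotc z z = (enorm z ^+ 2)%:C.
Proof.
by rewrite enorm_sqr rmorph_sum; apply: eq_bigr => j _; rewrite cabs_sqr.
Qed.

Lemma enorm0 : enorm (0 : 'rV[R[i]]_n) = 0.
Proof.
rewrite /enorm big1 ?sqrtr0 // => j _.
by rewrite mxE cabs0 expr0n.
Qed.

Lemma enormZ c z : enorm (c *: z) = cabs c * enorm z.
Proof.
rewrite /enorm -[cabs c]ger0_norm ?cabs_ge0 // -sqrtr_sqr -sqrtrM ?sqr_ge0 //.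
congr Num.sqrt; rewrite mulr_sumr; apply: eq_bigr => j _.
by rewrite mxE cabsM exprMn.
Qed.

Lemma enormN z : enorm (- z) = enorm z.
Proof. by rewrite -scaleN1r enormZ cabsN cabs1 mul1r. Qed.

Lemma enormB z w : enorm (z - w) = enorm (w - z).
Proof. by rewrite -enormN opprB. Qed.

Lemma cabs_coord z j : cabs (z ord0 j) <= enorm z.
Proof.
rewrite -(@ler_pXn2r _ 2) ?nnegrE ?cabs_ge0 ?enorm_ge0 // enorm_sqr.
rewrite (bigD1 j) //= lerDl; apply: sumr_ge0 => k _; exact: sqr_ge0.
Qed.

Lemma enorm0P z : enorm z = 0 -> z = 0.
Proof.
move=> z0; apply/rowP => j; rewrite mxE; apply: cabs0P.
by apply/le_anti; rewrite cabs_ge0 -z0 cabs_coord.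
Qed.

Lemma enorm_gt0 z : z != 0 -> 0 < enorm z.
Proof. by move=> h; rewrite lt0r enorm_ge0 andbT; apply: contraNneq h => /enorm0P->. Qed.

Lemma cauchy_schwarz z a : cabs (dotc z a) <= enorm z * enorm a.
Proof.
have [->|a0] := eqVneq a 0.
  by rewrite dotcC dotc0l rmorph0 cabs0 mulr_ge0 // enorm_ge0.
have B0 : 0 < enorm a ^+ 2 by rewrite exprn_gt0 // enorm_gt0.
pose u := (enorm a ^+ 2)%:C *: z - dotc z a *: a.
have E : dotc u u = ((enorm a ^+ 2) * (enorm z ^+ 2 * enorm a ^+ 2 - cabs (dotc z a) ^+ 2))%:C.
  rewrite /u !(dotcDl, dotcDr, dotcNl, dotcNr, dotcZl, dotcZr) !dotc_self conj_real.
  rewrite (dotcC a z) [RHS]rmorphM [in RHS]rmorphB [in RHS]rmorphM /= -cabs_sqr; ring.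
have : 0 <= enorm u ^+ 2 by exact: sqr_ge0.
rewrite -lecR -dotc_self E ler0c pmulr_rge0 // subr_ge0 -exprMn.
by rewrite ler_pXn2r ?nnegrE ?mulr_ge0 ?cabs_ge0 ?enorm_ge0.
Qed.

Lemma enormD z w : enorm (z + w) <= enorm z + enorm w.
Proof.
rewrite -(@ler_pXn2r _ 2) ?nnegrE ?addr_ge0 ?enorm_ge0 //.
have -> : enorm (z + w) ^+ 2 = enorm z ^+ 2 + (complex.Re (dotc z w) + complex.Re (dotc z w)) + enorm w ^+ 2.
  apply: complexI; rewrite -dotc_self !(dotcDl, dotcDr) !dotc_self.
  have /= E := addc_conj (dotc z w).
  by rewrite real_complexD (real_complexD (_ ^+ 2)) -E (dotcC w z) !addrA.
have := Re_le_cabs (dotc z w); have := cauchy_schwarz z w; nra.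
Qed.

Lemma enorm_dist z w : `|enorm z - enorm w| <= enorm (z - w).
Proof.
rewrite ler_norml; apply/andP; split.
  by have := enormD z (w - z); rewrite addrC subrK enormB; lra.
by have := enormD w (z - w); rewrite addrC subrK; lra.
Qed.

Lemma enorm_le_sum z : enorm z <= \sum_j cabs (z ord0 j).
Proof.
have s0 : 0 <= \sum_j cabs (z ord0 j) by apply: sumr_ge0 => j _; exact: cabs_ge0.
rewrite -(@ler_pXn2r _ 2) ?nnegrE ?enorm_ge0 // enorm_sqr expr2 mulr_suml.
apply: ler_sum => j _; rewrite expr2 ler_wpM2l ?cabs_ge0 //.
rewrite (bigD1 j) //= lerDl; apply: sumr_ge0 => k _; exact: cabs_ge0.
Qed.

End Hermitian.

(** * Extrema on closed balls *)

Section Compactness.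
Variables (R : realType) (n : nat).
Local Open Scope complex_scope.

Definition of_real_coords (v : 'rV[R]_(n + n)) : 'rV[R[i]]_n :=
  \row_j (v ord0 (lshift n j) +i* v ord0 (rshift n j)).

Lemma of_real_coordsB v w :
  of_real_coords v - of_real_coords w = of_real_coords (v - w).
Proof. by apply/rowP => j; rewrite !mxE. Qed.

Lemma of_real_coords_surj z : exists v, of_real_coords v = z.
Proof.
exists (row_mx (\row_j complex.Re (z ord0 j)) (\row_j complex.Im (z ord0 j))).
by apply/rowP => j; rewrite mxE row_mxEl row_mxEr !mxE; case: (z _ _).
Qed.

Lemma norm_coord_le m (v : 'rV[R]_m) j : `|v ord0 j| <= `|v|.
Proof.
rewrite [leRHS]/Num.norm /= mx_normrE; apply/bigmax_geP; right => /=.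
by exists (ord0, j).
Qed.

Lemma enorm_of_real_coords v : enorm (of_real_coords v) <= n%:R * 2 * `|v|.
Proof.
apply: le_trans (enorm_le_sum _) _.
apply: le_trans (_ : \sum_(j < n) (2 * `|v|) <= _).
  apply: ler_sum => j _; rewrite mxE; apply: le_trans (cabs_le_ReIm _) _ => /=.
  by rewrite mulr_natl mulr2n lerD // norm_coord_le.
by rewrite sumr_const card_ord -[leLHS]mulr_natl mulrA.
Qed.

Lemma norm_le_enorm v : `|v| <= enorm (of_real_coords v).
Proof.
rewrite [leLHS]/Num.norm /= mx_normrE; apply/bigmax_leP; split; first exact: enorm_ge0.
move=> [i j] _ /=; rewrite (ord1 i) -(splitK j).
case: (fintype.split j) => k /=; apply: le_trans (cabs_coord _ k); rewrite mxE.
  exact: le_trans (cabs_Re _).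
exact: le_trans (cabs_Im _).
Qed.

(** Transported to real coordinates, where closed bounded sets are compact. *)
Theorem closed_ball_min (F : 'rV[R[i]]_n -> R) (rho : R) : 0 <= rho ->
  (forall z, enorm z <= rho -> forall e, 0 < e -> exists2 d : R, 0 < d &
     forall w, enorm w <= rho -> enorm (w - z) < d -> `|F w - F z| < e) ->
  exists2 z, enorm z <= rho & forall w, enorm w <= rho -> F z <= F w.
Proof.
move=> rho0 FC.
pose A := [set v | enorm (of_real_coords v) <= rho].
have nearE (v : 'rV[R]_(n + n)) d : 0 < d ->
    \forall w \near v, enorm (of_real_coords w - of_real_coords v) < d.
  move=> d0; have D0 : 0 < n%:R * 2 + 1 :> R by rewrite ltr_wpDl // mulr_ge0.
  near=> w.
  rewrite of_real_coordsB; apply: le_lt_trans (enorm_of_real_coords _) _.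
  apply: le_lt_trans (_ : (n%:R * 2 + 1) * `|w - v| < _).
    by rewrite ler_wpM2r // lerDl.
  rewrite mulrC -ltr_pdivlMr // distrC.
  by near: w; apply: cvgr_dist_lt; rewrite ?divr_gt0.
have enC : continuous (fun v : 'rV[R]_(n + n) => enorm (of_real_coords v)).
  move=> v; apply/(@cvgrPdist_lt _ _ _ (nbhs v) (nbhs_filter v)) => e e0.
  apply: filterS (nearE v e e0) => w wv.
  by apply: le_lt_trans (enorm_dist _ _) _; rewrite enormB.
have cA : compact A.
  apply: bounded_closed_compact; last first.
    by apply: (@closed_comp _ _ _ [set x | x <= rho]) => // *; exact: closed_le.
  exists rho; split; first exact: num_real.
  move=> M rM v Av; apply: le_trans (norm_le_enorm _) _.
  exact: le_trans Av (ltW rM).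
have A0 : A !=set0.
  have [v Ev] := of_real_coords_surj 0; exists v.
  by rewrite /A /= Ev enorm0.
have cF : {within A, continuous (F \o of_real_coords)}.
  apply/subspace_continuousP => v Av; apply/cvgrPdist_lt => e e0.
  have [d d0 Hd] := FC _ Av _ e0.
  apply: filterS (nearE v d d0) => w wd Aw /=.
  by rewrite distrC; exact: Hd.
have [c] := EVT_min_rV A0 cA cF.
rewrite inE => Ac Hc; exists (of_real_coords c) => // w.
have [v <-] := of_real_coords_surj w => vr.
by apply: Hc; rewrite inE.
Unshelve. all: by end_near. Qed.

End Compactness.

(** * The maximum principle and the Schwarz lemma on discs *)

Section MaximumPrinciple.
Variable R : realType.
Implicit Types (z w : R[i]) (g H : R[i] -> R[i]) (rho r M B eps : R).
Local Open Scope complex_scope.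

Lemma ccont_conj H z : ccont H z -> ccont (fun w => Num.conj (H w)) z.
Proof.
move=> hH e e0; have [d d0 Hd] := hH e e0; exists d => // w /Hd.
by rewrite -rmorphB cabsJ.
Qed.

(** The function is given as the real part of a complex one, to which the rules for
[ccont] apply. *)
Lemma disc_max H rho : 0 <= rho -> (forall z, cabs z <= rho -> ccont H z) ->
  exists2 z0, cabs z0 <= rho &
    forall w, cabs w <= rho -> complex.Re (H w) <= complex.Re (H z0).
Proof.
move=> rho0 hH.
have E (v : 'rV[R[i]]_1) : enorm v = cabs (v ord0 ord0).
  by rewrite /enorm big_ord1 sqrtr_sqr ger0_norm // cabs_ge0.
have [|v hv Hv] := @closed_ball_min R 1 (fun v => - complex.Re (H (v ord0 ord0))) rho rho0.
  move=> z hz e e0; rewrite E in hz; have [d d0 Hd] := hH _ hz _ e0.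
  exists d => // w _; rewrite E !mxE => /Hd; apply: le_lt_trans.
  rewrite -opprD normrN; apply: le_trans (cabs_Re _); rewrite le_eqVlt.
  by case: (H _) (H _) => [a b] [c e'] /=; rewrite eqxx.
exists (v ord0 ord0); first by rewrite -E.
move=> w hw; have := Hv (const_mx w).
by rewrite E !mxE lerN2; apply.
Qed.

(** The defect in the Cauchy-Schwarz inequality for the vectors
(1, sqrt(eps) w) and (1, sqrt(eps) z0). *)
Lemma cabs_kernel eps z0 w : cabs (1 + eps%:C * Num.conj z0 * w) ^+ 2 =
  (1 + eps * cabs w ^+ 2) * (1 + eps * cabs z0 ^+ 2) - eps * cabs (w - z0) ^+ 2.
Proof. by case: z0 w => [a b] [c d]; rewrite !cabs2 /=; ring. Qed.

(** Let z0 be a maximum of |g|^2 (1 + eps |z|^2) and suppose it is interior.  The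
function p(w) = g(w) (1 + eps conj(z0) w) is the product of the vector
(g, sqrt(eps) w g) with its value at z0, up to a factor; by the strict
Cauchy-Schwarz inequality |p| is strictly smaller on an annulus around z0 than
at z0, against [local_max].  Then eps tends to 0. *)
Theorem maximum_principle g rho M : 0 < rho -> 
  (forall w, cabs w <= rho -> cdiff g w) ->
  (forall w, cabs w = rho -> cabs (g w) <= M) ->
  forall z, cabs z <= rho -> cabs (g z) <= M.
Proof.
move=> rho0 hg hM.
have M0 : 0 <= M.
  by apply: le_trans (cabs_ge0 (g rho%:C)) (hM _ _); rewrite cabs_real ger0_norm // ltW.
have key eps z : 0 < eps -> cabs z <= rho ->
    cabs (g z) ^+ 2 * (1 + eps * cabs z ^+ 2) <= M ^+ 2 * (1 + eps * rho ^+ 2).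
  move=> eps0 hz.
  pose H w := g w * Num.conj (g w) * (1 + eps%:C * (w * Num.conj w)).
  have HE w : H w = (cabs (g w) ^+ 2 * (1 + eps * cabs w ^+ 2))%:C.
    by rewrite /H !cabs_sqr real_complexM real_complexD real_complexM.
  have [z0 hz0 Hmax] : exists2 z0, cabs z0 <= rho &
    forall w, cabs w <= rho -> complex.Re (H w) <= complex.Re (H z0).
    apply: disc_max => [|w /hg /cdiff_cont gc]; first exact: ltW.
    apply: ccontM; first by apply: ccontM => //; exact: ccont_conj.
    apply: ccontD; first exact: ccont_cst.
    apply: ccontM; first exact: ccont_cst.
    by apply: ccontM; [|apply: ccont_conj]; exact: ccont_id.
  pose u w := cabs (g w) ^+ 2 * (1 + eps * cabs w ^+ 2).
  have {}Hmax w : cabs w <= rho -> u w <= u z0 by move=> /Hmax; rewrite !HE.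
  apply: le_trans (Hmax _ hz) _.
  have pos w : 1 <= 1 + eps * cabs w ^+ 2 by rewrite lerDl mulr_ge0 ?sqr_ge0 // ltW.
  move: hz0; rewrite le_eqVlt => /orP[/eqP hz0|hz0].
    rewrite /u hz0 ler_wpM2r //; first by rewrite -hz0 (le_trans ler01).
    by rewrite lerXn2r ?nnegrE ?cabs_ge0 // hM.
  have RHS0 : 0 <= M ^+ 2 * (1 + eps * rho ^+ 2).
    by rewrite mulr_ge0 ?sqr_ge0 // addr_ge0 // mulr_ge0 ?sqr_ge0 // ltW.
  rewrite leNgt; apply/negP => /(le_lt_trans RHS0) u0.
  pose p w := g w * (1 + eps%:C * Num.conj z0 * w).
  pose s := (rho - cabs z0) / 2.
  have s0 : 0 < s by rewrite /s divr_gt0 // subr_gt0.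
  have near w : cabs (w - z0) <= 2 * s -> cabs w <= rho.
    move=> h; have := cabsD z0 (w - z0); rewrite addrC subrK => h2.
    by apply: le_trans h2 _; move: h; rewrite /s; lra.
  (* K bounds |p|^2 on the annulus, where |w - z0| >= s/2; it is smaller than |p(z0)|^2. *)
  pose K := u z0 * ((1 + eps * cabs z0 ^+ 2) - eps * (s / 2) ^+ 2 / (1 + eps * rho ^+ 2)).
  have pK w : s / 2 <= cabs (w - z0) <= 2 * s -> cabs (p w) ^+ 2 <= K.
    move=> /andP[h1 h2]; rewrite cabsM exprMn cabs_kernel.
    have pw := pos w; have w1 : 0 < 1 + eps * cabs w ^+ 2 by exact: lt_le_trans pw.
    set D := cabs (w - z0) in h1 h2 *.
    have -> : cabs (g w) ^+ 2 * ((1 + eps * cabs w ^+ 2) * (1 + eps * cabs z0 ^+ 2)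
       - eps * D ^+ 2) = u w * (1 + eps * cabs z0 ^+ 2 - eps * D ^+ 2 / (1 + eps * cabs w ^+ 2)).
      by rewrite /u; field; rewrite gt_eqF.
    apply: ler_pM.
    - by rewrite /u mulr_ge0 ?sqr_ge0 // ltW.
    - rewrite subr_ge0 ler_pdivrMr // mulrC.
      have := sqr_ge0 (cabs (1 + eps%:C * Num.conj z0 * w)).
      by rewrite cabs_kernel -/D; lra.
    - exact/Hmax/near.
    rewrite lerD2l lerN2; apply: ler_pM.
    - by rewrite mulr_ge0 ?sqr_ge0 // ltW.
    - by rewrite invr_ge0 addr_ge0 // mulr_ge0 ?sqr_ge0 // ltW.
    - rewrite ler_pM2l // lerXn2r ?nnegrE ?cabs_ge0 //; lra.
    rewrite lef_pV2 ?posrE //; last by rewrite ltr_pwDl // mulr_ge0 ?sqr_ge0 // ltW.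
    by rewrite lerD2l ler_pM2l // lerXn2r ?nnegrE ?cabs_ge0 ?(ltW rho0) // near.
  have K0 : 0 <= K.
    apply: le_trans (sqr_ge0 (cabs (p (z0 + s%:C)))) (pK _ _).
    by rewrite addrC addKr cabs_real ger0_norm; lra.
  have : cabs (p z0) <= Num.sqrt K.
    apply: (local_max s0) => [w /near hw|w hw].
      apply: cdiffM; first exact: hg.
      apply: cdiffD; first exact: cdiff_cst.
      apply: cdiffM; [exact: cdiff_cst|exact: cdiff_id].
    by rewrite -[X in X <= _]ger0_norm ?cabs_ge0 // -sqrtr_sqr ler_wsqrtr // pK.
  rewrite -(@ler_pXn2r _ 2) ?nnegrE ?cabs_ge0 ?sqrtr_ge0 // sqr_sqrtr //.
  rewrite cabsM exprMn cabs_kernel subrr cabs0 expr0n mulr0 subr0 mulrA -/(u z0) /K.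
  rewrite ler_pM2l // leNgt => /negP; apply.
  have d1 : 0 < 1 + eps * rho ^+ 2 by rewrite ltr_pwDl // mulr_ge0 ?sqr_ge0 // ltW.
  by rewrite ltrBlDr ltrDl divr_gt0 // mulr_gt0 // exprn_gt0 // divr_gt0.
move=> z hz; rewrite -(@ler_pXn2r _ 2) ?nnegrE ?cabs_ge0 //.
apply/ler_addgt0Pr => e e0.
have D0 : 0 < M ^+ 2 * rho ^+ 2 + 1 by rewrite ltr_wpDl // mulr_ge0 ?sqr_ge0.
have e1 : 0 < e / (M ^+ 2 * rho ^+ 2 + 1) by rewrite divr_gt0.
have := key _ _ e1 hz; set q := e / _ => h.
have Eq : q * (M ^+ 2 * rho ^+ 2 + 1) = e by rewrite divfK ?gt_eqF.
apply: le_trans (_ : cabs (g z) ^+ 2 * (1 + q * cabs z ^+ 2) <= _).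
  by rewrite ler_peMr ?sqr_ge0 // lerDl mulr_ge0 ?sqr_ge0 // ltW.
by apply: le_trans h _; rewrite -Eq; have : 0 < q by []; lra.
Qed.

(** The maximum principle for g^(k+1) / z^k, which is holomorphic at 0 as well with
the convention 0 / 0 = 0, gives |g(z)|^(k+1) <= B^(k+1) (|z| / rho)^k for every
rho in ]|z|, r[.  Letting k grow avoids the removable singularity of g / z. *)
Theorem schwarz_disc g r B : 0 < r ->
  (forall w, cabs w < r -> cdiff g w) ->
  (forall w, cabs w < r -> cabs (g w) <= B) -> g 0 = 0 ->
  forall z, cabs z < r -> cabs (g z) * r <= B * cabs z.
Proof.
move=> r0 hg hB g0 z hz.
have B0 : 0 <= B by apply: le_trans (cabs_ge0 (g 0)) (hB _ _); rewrite cabs0.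
have [->|z0] := eqVneq z 0; first by rewrite g0 cabs0 mul0r mulr0.
have {z0}z0 := cabs_gt0 z0.
have key rho : cabs z < rho -> rho < r -> cabs (g z) * rho <= B * cabs z.
  move=> zr rr; have rho0 : 0 < rho by exact: lt_trans zr.
  rewrite -ler_pdivlMr //.
  apply: (@le_of_geometric_le _ _ _ (rho / cabs z)); first by rewrite divr_ge0 ?mulr_ge0 // ltW.
  case=> [|n]; first by rewrite !expr0 mulr1 ler_pdivlMr // mul1r ltW.
  pose p w := g w ^+ n.+1 * (w ^+ n)^-1.
  have pd w : cabs w <= rho -> cdiff p w.
    move=> wr; have hw := le_lt_trans wr rr.
    have [w0|w0] := eqVneq w 0; last first.
      apply: cdiffM; first by apply: cdiffX; exact: hg.
      by apply: cdiffV; [rewrite expf_neq0|apply: cdiffX; exact: cdiff_id].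
    rewrite w0 in hw *; have [psi hpsi E] := hg _ hw.
    exists (fun v => psi v ^+ n.+1).
      have : forall m, ccont (fun v => psi v ^+ m) 0.
        elim=> [|m IH]; first exact: ccont_cst.
        by under eq_fun do rewrite exprS; exact: ccontM.
      exact.
    move=> v; have Ev : g v = psi v * v by have := E v; rewrite g0 !subr0.
    have p0 : p 0 = 0 by rewrite /p g0 exprS !mul0r.
    rewrite p0 !subr0 /p Ev exprMn.
    have [->|v0] := eqVneq v 0; first by rewrite (exprS 0) !(mul0r, mulr0).
    by rewrite -mulrA (exprS v) -(mulrA v) divff ?mulr1 // expf_neq0.
  have pM w : cabs w = rho -> cabs (p w) <= B ^+ n.+1 / rho ^+ n.
    move=> wr; rewrite /p cabsM cabsV !cabsX wr ler_pM2r ?invr_gt0 ?exprn_gt0 //.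
    by rewrite lerXn2r ?nnegrE ?cabs_ge0 // hB // wr.
  have := maximum_principle rho0 pd pM (ltW zr).
  rewrite /p cabsM cabsV !cabsX ler_pdivrMr ?exprn_gt0 // => h.
  apply: le_trans h _; rewrite le_eqVlt; apply/orP; left; apply/eqP.
  by rewrite expr_div_n exprMn; move: z0 rho0 => /gt_eqF/negbT z0 /gt_eqF/negbT rho0;
     rewrite (exprS rho) (exprS (cabs z)); field; rewrite z0 rho0 expf_neq0.
(* Now let rho tend to r: pick rho between max(B |z| / |g(z)|, |z|) and r. *)
rewrite leNgt; apply/negP => h.
have gz : 0 < cabs (g z).
  by rewrite lt0r cabs_ge0 andbT; apply: contraTneq h => ->; rewrite mul0r -leNgt mulr_ge0 // ltW.
pose q := B * cabs z / cabs (g z).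
have qE : q * cabs (g z) = B * cabs z by rewrite divfK ?gt_eqF.
have qr : q < r by rewrite ltr_pdivrMr // (mulrC r).
pose t := Num.max q (cabs z).
have tr : t < r by rewrite gt_max qr hz.
have := key ((t + r) / 2).
have tz : cabs z <= t by rewrite le_max lexx orbT.
have tq : q <= t by rewrite le_max lexx.
have h1 : cabs z < (t + r) / 2 by lra.
have h2 : (t + r) / 2 < r by lra.
move=> /(_ h1 h2); rewrite -qE mulrC ler_pM2r // leNgt => /negP; apply; lra.
Qed.
End MaximumPrinciple.

(** * Differentials in several variables *)

Lemma differentiable_eps (K : numFieldType) (V W : normedModType K) (f : V -> W) (x : V) :
  differentiable f x -> forall e : K, 0 < e -> exists2 d : K, 0 < d &
    forall h, `|h| < d -> `|f (h + x) - f x - 'd f x h| <= e * `|h|.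
Proof.
move=> /diff_locally /eqaddoP H e e0.
have /nbhs_ballP[d /= d0 Hd] := H _ e0.
exists d => // h hd; have := Hd h; rewrite -ball_normE /= sub0r normrN => /(_ hd).
by rewrite !fctE opprD addrA.
Qed.

Lemma eps_differentiable (K : numFieldType) (V W : normedModType K) (f : V -> W)
    (df : {linear V -> W}) (x : V) : continuous df ->
  (forall e : K, 0 < e -> exists2 d : K, 0 < d &
    forall h, `|h| < d -> `|f (h + x) - f x - df h| <= e * `|h|) ->
  differentiable f x /\ 'd f x = df :> (V -> W).
Proof.
move=> dfC H.
have E : f \o shift x = cst (f x) + df +o_ 0 id.
  apply/eqaddoP => e e0; have [d d0 Hd] := H e e0.
  apply/nbhs_ballP; exists d => //= h.
  rewrite -ball_normE /= sub0r normrN => /Hd.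
  by rewrite !fctE opprD addrA.
have D := diff_unique dfC E.
split=> //; apply/diff_locallyP; split.
  by rewrite D.
by rewrite D.
Qed.

Lemma linear_bound_continuous (K : numFieldType) (V W : normedModType K)
    (df : {linear V -> W}) (C : K) : 0 < C -> (forall h, `|df h| <= C * `|h|) ->
  continuous df.
Proof.
move=> C0 H x; apply/(@cvgrPdist_lt _ _ _ (nbhs x) (nbhs_filter x)) => e e0.
have eC : 0 < e / C by rewrite divr_gt0.
apply/nbhs_ballP; exists (e / C) => //= y; rewrite -ball_normE /= => xy.
rewrite -linearB; apply: le_lt_trans (H _) _.
by rewrite mulrC -ltr_pdivlMr.
Qed.

Lemma mx_coord_le_norm (K : numFieldType) n (v : 'rV[K]_n) j : `|v ord0 j| <= `|v|.
Proof.
rewrite [leRHS]/Num.norm /= mx_normE -[leLHS]nngE num_le.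
exact: (le_bigmax _ (fun i : 'I_1 * 'I_n => `|v i.1 i.2|%:nng) (ord0, j)).
Qed.

Lemma mx_norm_le (K : numFieldType) n (v : 'rV[K]_n) (c : K) : 0 <= c ->
  (forall j, `|v ord0 j| <= c) -> `|v| <= c.
Proof.
move=> c0 H; have [->|v0] := eqVneq `|v| 0 => //.
have [[i j] E] := mx_norm_neq0 v0.
by rewrite [leLHS]E /= (ord1 i).
Qed.

Section Differential.
Variable R : realType.
Local Open Scope complex_scope.

(** Real epsilons and the Euclidean norm, in place of the complex-valued supremum
norm behind [differentiable]; the matrix acts on row vectors on the right, as
[jacobian] does. *)
Definition mdiff n m (f : 'rV[R[i]]_n -> 'rV[R[i]]_m) (z : 'rV[R[i]]_n)
    (A : 'M[R[i]]_(n, m)) :=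
  forall e : R, 0 < e -> exists2 d : R, 0 < d & forall w, enorm (w - z) < d ->
    enorm (f w - f z - (w - z) *m A) <= e * enorm (w - z).

Lemma sup_norm_le_enorm n (v : 'rV[R[i]]_n) : `|v| <= (enorm v)%:C.
Proof.
apply: mx_norm_le => [|j]; first by rewrite ler0c enorm_ge0.
by rewrite cabsE lecR cabs_coord.
Qed.

Lemma enorm_le_sup_norm n (v : 'rV[R[i]]_n) : (enorm v)%:C <= n.+1%:R * `|v|.
Proof.
apply: le_trans (_ : (\sum_j cabs (v ord0 j))%:C <= _).
  by rewrite lecR enorm_le_sum.
rewrite rmorph_sum /=; apply: le_trans (_ : \sum_(j < n) `|v| <= _).
  by apply: ler_sum => j _; rewrite -cabsE mx_coord_le_norm.
by rewrite sumr_const card_ord -[leLHS]mulr_natl ler_wpM2r ?normr_ge0 // ler_nat leqnSn.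
Qed.

Lemma gt0_real (c : R[i]) : 0 < c -> exists2 x : R, 0 < x & c = x%:C.
Proof.
case: c => a b; rewrite ltcE /= => /andP[/eqP -> a0].
by exists a.
Qed.

Lemma enorm_mulmx_le n m (A : 'M[R[i]]_(n, m)) (v : 'rV[R[i]]_n) :
  enorm (v *m A) <= (\sum_(j < m) \sum_(k < n) cabs (A k j)) * enorm v.
Proof.
apply: le_trans (enorm_le_sum _) _; rewrite mulr_suml; apply: ler_sum => j _.
rewrite mxE mulr_suml; apply: le_trans (ler_cabs_sum _ _ _) _; apply: ler_sum => k _.
by rewrite cabsM mulrC ler_wpM2l ?cabs_ge0 // cabs_coord.
Qed.

Lemma enorm_mulmx n m (A : 'M[R[i]]_(n, m)) :
  exists2 C : R, 0 < C & forall v, enorm (v *m A) <= C * enorm v.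
Proof.
exists (\sum_(j < m) \sum_(k < n) cabs (A k j) + 1) => [|v].
  by rewrite ltr_wpDl //; do 2!apply: sumr_ge0 => ? _; exact: cabs_ge0.
apply: le_trans (enorm_mulmx_le _ _) _.
by rewrite ler_wpM2r ?enorm_ge0 // lerDl.
Qed.

Lemma differentiable_mdiff n m (f : 'rV[R[i]]_n -> 'rV[R[i]]_m) z :
  differentiable f z -> mdiff f z (jacobian f z).
Proof.
move=> /differentiable_eps H e e0.
pose q : R := e / m.+1%:R.
have q0 : 0 < q%:C :> R[i] by rewrite ltcR divr_gt0.
have [d d0 Hd] := H _ q0; have [x x0 Ex] := gt0_real d0.
exists x => // w wx; have hd : `|w - z| < d.
  by rewrite Ex; apply: le_lt_trans (sup_norm_le_enorm _) _; rewrite ltcR.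
have := Hd _ hd; rewrite subrK /jacobian mul_rV_lin1 => h.
rewrite -lecR; apply: le_trans (enorm_le_sup_norm _) _.
apply: le_trans (ler_wpM2l _ h) _ => //.
rewrite mulrA /q.
have -> : m.+1%:R * (e / m.+1%:R)%:C = e%:C :> R[i].
  by rewrite real_complexM real_complexV rmorph_nat mulrC divfK.
rewrite real_complexM; apply: ler_wpM2l; first by rewrite ler0c ltW.
exact: sup_norm_le_enorm.
Qed.

Lemma mdiff_differentiable n m (f : 'rV[R[i]]_n -> 'rV[R[i]]_m) z A :
  mdiff f z A -> differentiable f z /\ jacobian f z = A.
Proof.
move=> H.
pose df : {linear 'rV[R[i]]_n -> 'rV[R[i]]_m} := mulmxr A.
have [C C0 HC] := enorm_mulmx A.
have dfC : continuous df.
  apply: (@linear_bound_continuous _ _ _ df (C * n.+1%:R)%:C) => [|h].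
    by rewrite ltcR mulr_gt0.
  apply: le_trans (sup_norm_le_enorm _) _.
  apply: le_trans (_ : C%:C * (enorm h)%:C <= _); first by rewrite -real_complexM lecR HC.
  rewrite real_complexM rmorph_nat -mulrA ler_wpM2l ?ler0c ?(ltW C0) //.
  exact: enorm_le_sup_norm.
have [|D E] := @eps_differentiable _ _ _ f df z dfC.
  move=> e e0; have [x x0 Ex] := gt0_real e0.
  have q0 : 0 < x / n.+1%:R by rewrite divr_gt0.
  have [d d0 Hd] := H _ q0; exists (d / n.+1%:R)%:C; first by rewrite ltcR divr_gt0.
  move=> h hd; have hd' : enorm (h + z - z) < d.
    rewrite addrK -ltcR; apply: le_lt_trans (enorm_le_sup_norm _) _.
    by move: hd; rewrite real_complexM real_complexV rmorph_nat ltr_pdivlMr // mulrC.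
  have := Hd _ hd'; rewrite addrK => h1.
  apply: le_trans (sup_norm_le_enorm _) _; rewrite Ex.
  apply: le_trans (_ : (x / n.+1%:R * enorm h)%:C <= _); first by rewrite lecR.
  rewrite real_complexM real_complexM real_complexV rmorph_nat -mulrA ler_wpM2l ?ler0c ?(ltW x0) //.
  by rewrite mulrC ler_pdivrMr // mulrC enorm_le_sup_norm.
split=> //; rewrite /jacobian; apply/row_matrixP => i.
by rewrite !rowE mul_rV_lin1 E.
Qed.

End Differential.

(** * The Schwarz lemma in several variables *)

Section SchwarzLemma.
Variable R : realType.
Local Open Scope complex_scope.

Lemma approx_cdiff (g : R[i] -> R[i]) z (l : R[i]) :
  (forall e : R, 0 < e -> exists2 d : R, 0 < d & forall w, cabs (w - z) < d ->
     cabs (g w - g z - l * (w - z)) <= e * cabs (w - z)) -> cdiff g z.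
Proof.
move=> H; exists (fun w => if w == z then l else (g w - g z) / (w - z)); last first.
  move=> w; case: eqVneq => [->|wz]; first by rewrite !subrr mulr0.
  by rewrite divfK // subr_eq0.
move=> e e0; have e20 : 0 < e / 2 by rewrite divr_gt0.
have [d d0 Hd] := H _ e20; exists d => // w /Hd; rewrite eqxx.
case: eqVneq => [_ _|wz h]; first by rewrite subrr cabs0.
have wz0 : w - z != 0 by rewrite subr_eq0.
apply: le_lt_trans (_ : e / 2 < e); last by lra.
rewrite -(ler_pM2r (cabs_gt0 wz0)) -cabsM mulrBl divfK //.
Qed.

(** Reduces several variables to one: restrict to a complex line and pair with a
fixed vector. *)
Lemma mdiff_line_cdiff n m (f : 'rV[R[i]]_n -> 'rV[R[i]]_m) p u q (t : R[i]) A :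
  mdiff f (p + t *: u) A -> cdiff (fun s => dotc (f (p + s *: u)) q) t.
Proof.
move=> H; apply: (@approx_cdiff _ _ (dotc (u *m A) q)) => e e0.
pose C := enorm u * enorm q + 1; pose c := enorm u + 1.
have C0 : 0 < C by rewrite ltr_wpDl // mulr_ge0 // enorm_ge0.
have c0 : 0 < c by rewrite ltr_wpDl // enorm_ge0.
have [d d0 Hd] := H (e / C) (divr_gt0 e0 C0).
exists (d / c); first by rewrite divr_gt0.
move=> s st.
have E : p + s *: u - (p + t *: u) = (s - t) *: u.
  by rewrite opprD addrACA subrr add0r scalerBl.
have hs : enorm (p + s *: u - (p + t *: u)) < d.
  rewrite E enormZ; apply: le_lt_trans (_ : cabs (s - t) * c < _).
    by rewrite ler_wpM2l ?cabs_ge0 // /c lerDl.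
  by rewrite -ltr_pdivlMr.
have := Hd _ hs; rewrite E => h.
have -> : dotc (f (p + s *: u)) q - dotc (f (p + t *: u)) q - dotc (u *m A) q * (s - t)
   = dotc (f (p + s *: u) - f (p + t *: u) - (s - t) *: u *m A) q.
  by rewrite !(dotcDl, dotcNl) -scalemxAl dotcZl; ring.
apply: le_trans (cauchy_schwarz _ _) _.
apply: le_trans (ler_wpM2r (enorm_ge0 _) h) _.
rewrite enormZ.
have -> : e / C * (cabs (s - t) * enorm u) * enorm q =
  (e * cabs (s - t)) * ((enorm u * enorm q) / C) by ring.
apply: ler_piMr; first by rewrite mulr_ge0 ?cabs_ge0 // ltW.
by rewrite ler_pdivrMr // mul1r /C lerDl.
Qed.

(** Restrict h to the complex line through z and pair with h(z): the resulting
function of one variable is bounded by B |h(z)| and takes the value |h(z)|^2 at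
|z|. *)
Theorem schwarz_lemma n m (h : 'rV[R[i]]_n -> 'rV[R[i]]_m) (r B : R) : 0 < r ->
  (forall z, enorm z < r -> exists A, mdiff h z A) ->
  (forall z, enorm z < r -> enorm (h z) <= B) -> h 0 = 0 ->
  forall z, enorm z < r -> enorm (h z) * r <= B * enorm z.
Proof.
move=> r0 hd hB h0 z hz.
have B0 : 0 <= B by apply: le_trans (enorm_ge0 (h 0)) (hB _ _); rewrite enorm0.
have [->|z0] := eqVneq z 0; first by rewrite h0 !enorm0 mul0r mulr0.
have {z0}z0 := enorm_gt0 z0.
have [->|q0] := eqVneq (h z) 0; first by rewrite enorm0 mul0r mulr_ge0 // ltW.
have {q0}q0 := enorm_gt0 q0.
pose u := ((enorm z)^-1)%:C *: z.
have u1 : enorm u = 1.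
  by rewrite enormZ cabs_real ger0_norm ?invr_ge0 ?enorm_ge0 // mulVf // gt_eqF.
have uz : (enorm z)%:C *: u = z.
  by rewrite /u scalerA -real_complexM divff ?gt_eqF // scale1r.
pose g t := dotc (h (0 + t *: u)) (h z).
have gz : cabs (enorm z)%:C < r by rewrite cabs_real ger0_norm ?enorm_ge0.
have lt_r (t : R[i]) : cabs t < r -> enorm (0 + t *: u) < r.
  by move=> tr; rewrite add0r enormZ u1 mulr1.
have gd t : cabs t < r -> cdiff g t.
  by move=> /lt_r /hd[A]; exact: mdiff_line_cdiff.
have gB t : cabs t < r -> cabs (g t) <= B * enorm (h z).
  move=> /lt_r /hB ht; apply: le_trans (cauchy_schwarz _ _) _.
  by rewrite ler_wpM2r ?enorm_ge0.
have g0 : g 0 = 0 by rewrite /g scale0r addr0 h0 dotc0l.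
have := schwarz_disc r0 gd gB g0 gz.
have -> : g (enorm z)%:C = (enorm (h z) ^+ 2)%:C by rewrite /g add0r uz dotc_self.
rewrite !cabs_real !ger0_norm ?sqr_ge0 ?enorm_ge0 // expr2 => H.
by rewrite -(ler_pM2r q0); lra.
Qed.

End SchwarzLemma.

(** * The chain rule and the involutions of the ball *)

Section ChainRule.
Variable R : realType.
Local Open Scope complex_scope.

Lemma mdiff_comp n m p (f : 'rV[R[i]]_n -> 'rV[R[i]]_m) (g : 'rV[R[i]]_m -> 'rV[R[i]]_p) z A B :
  mdiff f z A -> mdiff g (f z) B -> mdiff (g \o f) z (A *m B).
Proof.
move=> hf hg e e0.
have [CA CA0 HA] := enorm_mulmx A; have [CB CB0 HB] := enorm_mulmx B.
have [dg dg0 Hg] := hg (e / (2 * (CA + 1))) ltac:(by rewrite divr_gt0 // mulr_gt0 // addr_gt0).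
pose e2 := Num.min 1 (e / (2 * CB)).
have e20 : 0 < e2 by rewrite lt_min ltr01 divr_gt0 // mulr_gt0.
have [df df0 Hf] := hf e2 e20.
exists (Num.min df (dg / (CA + 1))).
  by rewrite lt_min df0 divr_gt0 // addr_gt0.
move=> w; rewrite lt_min => /andP[/Hf h1 h2].
have e21 : e2 <= 1 by rewrite ge_min lexx.
have e22 : e2 <= e / (2 * CB) by rewrite ge_min lexx orbT.
have fw : enorm (f w - f z) <= (CA + 1) * enorm (w - z).
  have -> : f w - f z = (f w - f z - (w - z) *m A) + (w - z) *m A by rewrite subrK.
  apply: le_trans (enormD _ _) _; rewrite mulrDl mul1r addrC lerD //.
  apply: le_trans h1 _; by rewrite ler_piMl ?enorm_ge0.
have fwd : enorm (f w - f z) < dg.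
  apply: le_lt_trans fw _; rewrite mulrC -ltr_pdivlMr //; exact: addr_gt0.
have -> : (g \o f) w - (g \o f) z - (w - z) *m (A *m B) =
   (g (f w) - g (f z) - (f w - f z) *m B) + (f w - f z - (w - z) *m A) *m B.
  by rewrite /= [(f w - f z - _) *m B]mulmxBl mulmxA addrA subrK.
apply: le_trans (enormD _ _) _; rewrite [e in leRHS]splitr mulrDl; apply: lerD.
  apply: le_trans (Hg _ fwd) _.
  apply: le_trans (ler_wpM2l _ fw) _; first by rewrite divr_ge0 ?mulr_ge0 ?addr_ge0 // ltW.
  rewrite le_eqVlt; apply/orP; left; apply/eqP; field.
  by rewrite gt_eqF // addr_gt0.
apply: le_trans (HB _) _; apply: le_trans (ler_wpM2l (ltW CB0) h1) _.
rewrite mulrA ler_wpM2r ?enorm_ge0 //.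
apply: le_trans (ler_wpM2l (ltW CB0) e22) _.
by rewrite le_eqVlt; apply/orP; left; apply/eqP; field; rewrite gt_eqF.
Qed.

(** Increments of the involutions below have this form, with c the reciprocal of
their denominator. *)
Lemma scalar_slope_mdiff n m (f : 'rV[R[i]]_n -> 'rV[R[i]]_m) z (c : 'rV[R[i]]_n -> R[i]) A
    (r : R) : 0 < r ->
  (forall e : R, 0 < e -> exists2 d : R, 0 < d &
     forall w, enorm (w - z) < d -> cabs (c w - c z) <= e) ->
  (forall w, enorm (w - z) < r -> f w - f z = c w *: ((w - z) *m A)) ->
  mdiff f z (c z *: A).
Proof.
move=> r0 hc hf e e0; have [C C0 HC] := enorm_mulmx A.
have [d d0 Hd] := hc (e / C) (divr_gt0 e0 C0).
exists (Num.min d r); first by rewrite lt_min d0.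
move=> w; rewrite lt_min => /andP[/Hd h1 /hf ->].
rewrite -scalemxAr -scalerBl enormZ.
apply: le_trans (ler_pM (cabs_ge0 _) (enorm_ge0 _) h1 (HC _)) _.
by rewrite mulrA divfK // gt_eqF.
Qed.

End ChainRule.

(** The increment between z and w of a quotient of affine maps is the reciprocal of
the denominator at w times a linear function of w - z; here cw and cz stand for
<w,a> and <z,a>, and u for a. *)
Lemma slope_identity (F : fieldType) n (cw cz k s : F) (x y u : 'rV[F]_n) :
  1 - cw != 0 -> 1 - cz != 0 ->
  (1 - cw)^-1 *: (u - s *: x - (k * cw) *: u) - (1 - cz)^-1 *: (u - s *: y - (k * cz) *: u) =
  (1 - cw)^-1 *: (- (s *: (x - y)) - k *: ((cw - cz) *: u) +
    (cw - cz) *: ((1 - cz)^-1 *: (u - s *: y - (k * cz) *: u))).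
Proof.
by move=> h1 h2; apply/rowP => j; rewrite !mxE; field; rewrite h1 h2.
Qed.

Section BallAutomorphism.
Variables (R : realType) (n : nat).
Implicit Types (a z w : 'rV[R[i]]_n).
Local Open Scope complex_scope.

Definition mob_s a : R := Num.sqrt (1 - enorm a ^+ 2).

(** The involutive automorphism of the ball exchanging 0 and a.  With P the
orthogonal projection onto the line of a and s = sqrt(1 - |a|^2) it is
(a - P z - s (z - P z)) / (1 - <z,a>).  Writing (1 - s) / |a|^2 = 1 / (1 + s)
makes the formula meaningful for a = 0. *)
Definition mob a z : 'rV[R[i]]_n := (1 - dotc z a)^-1 *:
  (a - (mob_s a)%:C *: z - ((1 + mob_s a)^-1%:C * dotc z a) *: a).

Lemma enorm_lt1_sqr z : enorm z < 1 -> 0 < 1 - enorm z ^+ 2.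
Proof. by move=> h; rewrite subr_gt0 expr_lt1 // enorm_ge0. Qed.

Lemma mob_s_gt0 a : enorm a < 1 -> 0 < mob_s a.
Proof. by move=> /enorm_lt1_sqr h; rewrite sqrtr_gt0. Qed.

Lemma mob_s_sqr a : enorm a < 1 -> mob_s a ^+ 2 = 1 - enorm a ^+ 2.
Proof. by move=> /enorm_lt1_sqr /ltW h; rewrite sqr_sqrtr. Qed.

Lemma enorm_sqr_mob_s a : enorm a < 1 ->
  (enorm a ^+ 2)%:C = 1 - (mob_s a)%:C ^+ 2 :> R[i].
Proof. by move=> h; rewrite -real_complexX mob_s_sqr // real_complexB subKr. Qed.

Lemma mob_s1_neq0 a : 1 + (mob_s a)%:C != 0 :> R[i].
Proof.
rewrite -(real_complexD 1) (inj_eq (@complexI _) _ 0) gt_eqF // ltr_pwDl //.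
exact: sqrtr_ge0.
Qed.

Lemma mob_s_neq0 a : enorm a < 1 -> (mob_s a)%:C != 0 :> R[i].
Proof. by move=> /mob_s_gt0 h; rewrite (inj_eq (@complexI _) _ 0) gt_eqF. Qed.

Lemma cabs_dotc_lt1 z a : enorm z < 1 -> enorm a < 1 -> cabs (dotc z a) < 1.
Proof.
move=> z1 a1; apply: le_lt_trans (cauchy_schwarz _ _) _.
by rewrite mulr_ilt1 ?enorm_ge0.
Qed.

Lemma mob_den_neq0 z a : enorm z < 1 -> enorm a < 1 -> 1 - dotc z a != 0.
Proof.
move=> z1 a1; apply/negP; rewrite subr_eq0 => /eqP E.
by have := cabs_dotc_lt1 z1 a1; rewrite -E cabs1 ltxx.
Qed.

(** Equivalent to the identity for 1 - |mob a z|^2, on which everything about the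
geometry of the ball relies. *)
Lemma mob_num_sqr a z : enorm a < 1 ->
  enorm (a - (mob_s a)%:C *: z - ((1 + mob_s a)^-1%:C * dotc z a) *: a) ^+ 2 =
  cabs (1 - dotc z a) ^+ 2 - (1 - enorm a ^+ 2) * (1 - enorm z ^+ 2).
Proof.
move=> a1; apply: complexI; rewrite -dotc_self.
rewrite !(dotcDl, dotcDr, dotcNl, dotcNr, dotcZl, dotcZr) !dotc_self.
rewrite (dotcC a z) !conjM !conj_real.
have Ea := enorm_sqr_mob_s a1; have Ec := cabs_sqr (1 - dotc z a).
have s1 := mob_s1_neq0 a.
rewrite conjB rmorph1 in Ec.
move: (enorm a ^+ 2) (enorm z ^+ 2) (cabs _ ^+ 2) Ea Ec => A Z C Ea Ec.
rewrite !(real_complexB, real_complexM) -Ec real_complexV real_complexD real_complex1 Ea; field; exact: s1.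
Qed.

Lemma mob_sqr a z : enorm a < 1 -> enorm z < 1 ->
  1 - enorm (mob a z) ^+ 2 =
  (1 - enorm a ^+ 2) * (1 - enorm z ^+ 2) / cabs (1 - dotc z a) ^+ 2.
Proof.
move=> a1 z1; rewrite /mob enormZ exprMn mob_num_sqr // cabsV.
field; rewrite gt_eqF // cabs_gt0 //; exact: mob_den_neq0.
Qed.

Lemma mob_ball a z : enorm a < 1 -> enorm z < 1 -> enorm (mob a z) < 1.
Proof.
move=> a1 z1.
have D0 := cabs_gt0 (mob_den_neq0 z1 a1).
have : 0 < 1 - enorm (mob a z) ^+ 2.
  by rewrite mob_sqr // divr_gt0 ?mulr_gt0 ?enorm_lt1_sqr // exprn_gt0.
by rewrite subr_gt0 expr_lt1 // enorm_ge0.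
Qed.

Lemma mob_center a : enorm a < 1 -> mob a a = 0.
Proof.
move=> a1; rewrite /mob dotc_self (enorm_sqr_mob_s a1).
apply/rowP => j; rewrite !mxE real_complexV real_complexD real_complex1; field.
by rewrite mob_s1_neq0 subKr expf_neq0 // mob_s_neq0.
Qed.

Lemma mob_dotc a z : enorm a < 1 -> enorm z < 1 ->
  1 - dotc (mob a z) a = (1 - (enorm a ^+ 2)%:C) / (1 - dotc z a).
Proof.
move=> a1 z1; rewrite /mob !(dotcDl, dotcNl, dotcZl) dotc_self.
rewrite (enorm_sqr_mob_s a1) real_complexV real_complexD real_complex1; field.
by rewrite mob_s1_neq0 mob_den_neq0.
Qed.

Lemma mobK a z : enorm a < 1 -> enorm z < 1 -> mob a (mob a z) = z.
Proof.
move=> a1 z1; have D0 := mob_den_neq0 z1 a1.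
have E := mob_dotc a1 z1; have E2 : dotc (mob a z) a = 1 - (1 - (enorm a ^+ 2)%:C) / (1 - dotc z a).
  by rewrite -E subKr.
have s0 := mob_s_neq0 a1.
rewrite {1}/mob E E2 (enorm_sqr_mob_s a1) subKr /mob.
apply/rowP => j; rewrite !mxE real_complexV real_complexD real_complex1; field.
by rewrite D0 s0 mob_s1_neq0.
Qed.

Lemma mob0 a : mob a 0 = a.
Proof.
by rewrite /mob dotc0l subr0 invr1 scale1r scaler0 mulr0 scale0r !subr0.
Qed.

(** The matrix of h |-> <h,a> v. *)
Definition rank1 a (v : 'rV[R[i]]_n) : 'M[R[i]]_n := (map_mx Num.conj a)^T *m v.

Lemma mul_rank1 a v h : h *m rank1 a v = dotc h a *: v.
Proof.
rewrite /rank1 mulmxA; apply/rowP => j; rewrite !mxE big_ord1; congr (_ * _).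
by rewrite mxE; apply: eq_bigr => k _; rewrite !mxE.
Qed.

Definition mob_diff a z : 'M[R[i]]_n := (1 - dotc z a)^-1 *:
  (- (mob_s a)%:C%:M - (1 + mob_s a)^-1%:C *: rank1 a a + rank1 a (mob a z)).

Lemma mob_mdiff a z : enorm a < 1 -> enorm z < 1 -> mdiff (mob a) z (mob_diff a z).
Proof.
move=> a1 z1.
apply: (@scalar_slope_mdiff _ _ _ _ _ (fun w => (1 - dotc w a)^-1) _ (1 - enorm z)).
- by rewrite subr_gt0.
- move=> e e0.
  pose D z := cabs (1 - dotc z a).
  have Dz : 0 < D z by apply: cabs_gt0; exact: mob_den_neq0.
  exists (Num.min (D z / 2) (e * (D z / 2 * D z))).
    by rewrite lt_min divr_gt0 // mulr_gt0 // mulr_gt0 // divr_gt0.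
  move=> w; rewrite lt_min => /andP[h1 h2].
  have h : cabs (dotc (w - z) a) <= enorm (w - z).
    apply: le_trans (cauchy_schwarz _ _) _; by rewrite ler_piMr ?enorm_ge0 // ltW.
  have Dw : D z / 2 < D w.
    have := cabsD (1 - dotc w a) (dotc (w - z) a).
    rewrite dotcDl dotcNl (_ : 1 - dotc w a + _ = 1 - dotc z a); last by ring.
    rewrite -/(D z) -/(D w) -dotcNl -dotcDl; lra.
  have Dw0 : 0 < D w by apply: lt_trans Dw; rewrite divr_gt0.
  have w0 : 1 - dotc w a != 0.
    by apply/negP => /eqP w0; move: Dw0; rewrite /D w0 cabs0 ltxx.
  have -> : (1 - dotc w a)^-1 - (1 - dotc z a)^-1 =
     dotc (w - z) a / ((1 - dotc w a) * (1 - dotc z a)).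
    by rewrite dotcDl dotcNl; field; rewrite w0 mob_den_neq0.
  rewrite cabsM cabsV cabsM -/(D w) -/(D z) ler_pdivrMr; last exact: mulr_gt0.
  apply: le_trans h _; apply: le_trans (ltW h2) _.
  by rewrite ler_pM2l // ler_pM2r // ltW.
move=> w hw.
have w1 : enorm w < 1.
  have -> : w = (w - z) + z by rewrite subrK.
  by apply: le_lt_trans (enormD _ _) _; lra.
have Dw := mob_den_neq0 w1 a1; have Dz := mob_den_neq0 z1 a1.
rewrite mulmxDr mulmxBr mulmxN mul_mx_scalar -scalemxAr !mul_rank1 dotcDl dotcNl /mob.
exact: (slope_identity (1 + mob_s a)^-1%:C (mob_s a)%:C _ _ _ Dw Dz).
Qed.

End BallAutomorphism.

(** * The Jacobian determinant of the involutions *)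

(** Multiplying the block matrix with rows (1, -v) and (u, 1) by a unipotent one on
either side computes its determinant in two ways. *)
Lemma det_rank_one (F : comPzRingType) n (u : 'cV[F]_n) (v : 'rV[F]_n) :
  \det (1%:M + u *m v) = 1 + (v *m u) ord0 ord0.
Proof.
pose M := block_mx (1%:M : 'M_1) (- v) u (1%:M : 'M_n).
pose L := block_mx (1%:M : 'M[F]_1) (0 : 'rV_n) (- u) (1%:M : 'M_n).
have dL : \det L = 1 by rewrite det_lblock !det1 mulr1.
have E1 : L *m M = block_mx 1%:M (- v) 0 (1%:M + u *m v).
  rewrite mulmx_block !mul1mx !mul0mx !mulmx1 !addr0 addNr.
  by rewrite mulmxN mulNmx opprK addrC.
have E2 : M *m L = block_mx (1%:M + v *m u) (- v) 0 1%:M.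
  rewrite mulmx_block !mul1mx !mulmx1 !mulmx0 !add0r mulmxN mulNmx opprK.
  by rewrite subrr.
have := det_mulmx L M; have := det_mulmx M L.
rewrite E1 E2 !det_ublock !det1 dL !mul1r !mulr1 => <- ->.
by rewrite det_mx11 !mxE eqxx.
Qed.

Lemma det_scaled_rank_one (F : fieldType) n (d s k : F) (u : 'cV[F]_n) (v : 'rV[F]_n) :
  s != 0 -> \det (d^-1 *: (- s%:M - k *: (u *m v) + u *m 0)) =
  (- s / d) ^+ n * (1 + k / s * (v *m u) ord0 ord0).
Proof.
move=> s0; have -> : d^-1 *: (- s%:M - k *: (u *m v) + u *m 0) =
    (- s / d) *: (1%:M + u *m ((k / s) *: v)).
  rewrite mulmx0 addr0 -scalemxAr; move: (u *m v) => X.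
  apply/matrixP => i j; rewrite !mxE; have [->|d0] := eqVneq d 0.
    by rewrite invr0 mulr0 !mul0r.
  by case: (i == j); rewrite /= ?mulr1n ?mulr0n; field; rewrite s0 d0.
by rewrite detZ det_rank_one -scalemxAl mxE.
Qed.

Section BallGeometry.
Variables (R : realType) (n : nat).
Implicit Types (a z w : 'rV[R[i]]_n) (f : 'rV[R[i]]_n -> 'rV[R[i]]_n).
Local Open Scope complex_scope.

Lemma det_mob_diff a : enorm a < 1 ->
  cabs (\det (mob_diff a a)) = (mob_s a)^-1 ^+ n.+1.
Proof.
move=> a1; have s0 := mob_s_gt0 a1; have s0' := mob_s_neq0 a1.
have s1 := mob_s1_neq0 a.
set s := (mob_s a)%:C in s0' s1 *.
have Ed : 1 - dotc a a = s ^+ 2 by rewrite dotc_self (enorm_sqr_mob_s a1) subKr.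
have Ea : (a *m (map_mx Num.conj a)^T) ord0 ord0 = 1 - s ^+ 2.
  rewrite -(enorm_sqr_mob_s a1) -dotc_self mxE; apply: eq_bigr => j _.
  by rewrite !mxE.
rewrite /mob_diff mob_center // Ed -/s /rank1 det_scaled_rank_one // Ea real_complexV real_complexD real_complex1 -/s.
have -> : - s / s ^+ 2 = - s^-1 by field.
have -> : 1 + (1 + s)^-1 / s * (1 - s ^+ 2) = s^-1 by field; rewrite s0' s1.
rewrite cabsM cabsX cabsN cabsV /s cabs_real ger0_norm ?exprSr //.
exact: ltW.
Qed.

End BallGeometry.

(** * The Schwarz-Pick inequality and Kobayashi balls *)

Section Kobayashi.
Variables (R : realType) (n : nat).
Implicit Types (a z w : 'rV[R[i]]_n) (f T S : 'rV[R[i]]_n -> 'rV[R[i]]_n).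
Local Open Scope complex_scope.

Lemma unit_ballE z : unit_ball z <-> enorm z < 1.
Proof. by rewrite /unit_ball /eball /= subr0. Qed.

Lemma holomorphic_self_mapP f : holomorphic_self_map f <->
  (forall z, enorm z < 1 -> exists A, mdiff f z A) /\
  (forall z, enorm z < 1 -> enorm (f z) < 1).
Proof.
split=> [[hd hb]|[hd hb]]; split.
- move=> z /unit_ballE /hd h; exists (jacobian f z); exact: differentiable_mdiff.
- by move=> z /unit_ballE /hb /unit_ballE.
- by move=> z /unit_ballE /hd[A /mdiff_differentiable[]].
- by move=> z /unit_ballE /hb /unit_ballE.
Qed.

Lemma schwarz_ball f : holomorphic_self_map f -> f 0 = 0 ->
  forall z, enorm z < 1 -> enorm (f z) <= enorm z.
Proof.
move=> /holomorphic_self_mapP[hd hb] f0 z z1.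
have := @schwarz_lemma R n n f 1 1 ltr01 hd _ f0 z z1; rewrite mulr1 mul1r; apply.
by move=> w /hb /ltW.
Qed.

Lemma holomorphic_self_map_comp f g : holomorphic_self_map f ->
  holomorphic_self_map g -> holomorphic_self_map (g \o f).
Proof.
move=> /holomorphic_self_mapP[fd fb] /holomorphic_self_mapP[gd gb].
apply/holomorphic_self_mapP; split=> [z z1|z /fb /gb //].
have [A hA] := fd _ z1; have [B hB] := gd _ (fb _ z1).
by exists (A *m B); exact: mdiff_comp.
Qed.

Lemma mob_self_map a : enorm a < 1 -> holomorphic_self_map (mob a).
Proof.
move=> a1; apply/holomorphic_self_mapP; split=> z z1; last exact: mob_ball.
by exists (mob_diff a z); exact: mob_mdiff.
Qed.

(** The Schwarz lemma for f conjugated by the involutions at a and f(a). *)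
Lemma schwarz_pick f a z : holomorphic_self_map f -> enorm a < 1 -> enorm z < 1 ->
  enorm (mob (f a) (f z)) <= enorm (mob a z).
Proof.
move=> hf a1 z1; have [_ fb] := (holomorphic_self_mapP f).1 hf.
have fa1 := fb _ a1.
have h : holomorphic_self_map (mob (f a) \o (f \o mob a)).
  apply: holomorphic_self_map_comp; last exact: mob_self_map.
  apply: holomorphic_self_map_comp; last exact: hf.
  exact: mob_self_map.
have h0 : (mob (f a) \o (f \o mob a)) 0 = 0 by rewrite /comp mob0 mob_center.
have := schwarz_ball h h0 (mob_ball a1 z1).
by rewrite /comp mobK.
Qed.

Lemma mob_automorphism a : enorm a < 1 -> ball_automorphism (mob a).
Proof.
move=> a1; split; first exact: mob_self_map.
exists (mob a); first exact: mob_self_map.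
by split=> z; rewrite inE => /unit_ballE z1; rewrite mobK.
Qed.

Lemma to_originP a : enorm a < 1 ->
  ball_automorphism (to_origin a) /\ to_origin a a = 0.
Proof.
move=> a1.
have ex : exists T, [set T | ball_automorphism T /\ T a = 0] T.
  by exists (mob a); split; [exact: mob_automorphism|exact: mob_center].
rewrite /to_origin; case: xgetP => [T _ //|no].
by have [T /no] := ex.
Qed.

(** The composite of mob a with the inverse of the chosen automorphism fixes 0, so
the Schwarz lemma applies to it.  This makes the choice in [to_origin] harmless. *)
Lemma mob_le_to_origin a z : enorm a < 1 -> enorm z < 1 ->
  enorm (mob a z) <= enorm (to_origin a z).
Proof.
move=> a1 z1; have [[hT [S hS [TS ST]]] Ta] := to_originP a1.
have B w : enorm w < 1 -> w \in @unit_ball R n by move=> w1; rewrite inE; apply/unit_ballE.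
have h := holomorphic_self_map_comp hS (mob_self_map a1).
have S0 : S 0 = a by rewrite -Ta TS // B.
have h0 : (mob a \o S) 0 = 0 by rewrite /comp S0 mob_center.
have [_ Tb] := (holomorphic_self_mapP _).1 hT.
have := schwarz_ball h h0 (Tb _ z1).
by rewrite /comp TS // B.
Qed.

(** The Kobayashi distance from 0 to a point of norm rho. *)
Definition artanh (rho : R) : R := 2^-1 * ln ((1 + rho) / (1 - rho)).

Lemma artanh_gt0 rho : 0 < rho -> rho < 1 -> 0 < artanh rho.
Proof.
move=> r0 r1; rewrite mulr_gt0 // ln_gt0 // ltr_pdivlMr ?subr_gt0 //; lra.
Qed.

Lemma kobayashi_ball_mob w z rho : enorm w < 1 -> 0 < rho -> rho < 1 ->
  kobayashi_ball w (artanh rho) z -> enorm z < 1 /\ enorm (mob w z) < rho.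
Proof.
move=> w1 r0 r1 [/unit_ballE z1 b]; split; first exact: z1.
apply: le_lt_trans (mob_le_to_origin w1 z1) _.
have [[/holomorphic_self_mapP[_ hb] _] _] := to_originP w1.
have t1 := hb _ z1; have t0 := enorm_ge0 (to_origin w z).
move: b; rewrite /kobayashi_dist /artanh; set t := enorm _ in t0 t1 *.
rewrite ltr_pM2l // ltr_ln ?posrE ?divr_gt0 ?subr_gt0 //; [|lra..].
rewrite ltr_pdivrMr ?subr_gt0 // mulrAC ltr_pdivlMr ?subr_gt0 //; nra.
Qed.

(** The Schwarz-Pick inequality between a and z, with the factors 1 - |mob|^2
expressed by [mob_sqr].  The bounds |1 - <f(z),f(a)>| >= 1 - |f(z)| and
1 - |f(a)|^2 <= 2 A (1 - |a|^2) leave only quantities at z and the distance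
from z to a. *)
Lemma julia_inequality f a z (A : R) : holomorphic_self_map f -> enorm a < 1 -> enorm z < 1 ->
  (1 - enorm (f a)) / (1 - enorm a) <= A ->
  (1 - enorm (f z)) * (1 - enorm z ^+ 2) <= 4 * A * cabs (1 - dotc z a) ^+ 2.
Proof.
move=> hf a1 z1 hA.
have [_ fb] := (holomorphic_self_mapP f).1 hf.
have fa1 := fb _ a1; have fz1 := fb _ z1.
have mono (x y X Y : R) : 0 <= x -> x <= y -> 1 - y ^+ 2 = Y -> 1 - x ^+ 2 = X -> Y <= X.
  by move=> x0 xy <- <-; nra.
have := mono _ _ _ _ (enorm_ge0 _) (schwarz_pick hf a1 z1) (mob_sqr a1 z1) (mob_sqr fa1 fz1).
set D := cabs (1 - dotc z a) ^+ 2; set E := cabs (1 - dotc (f z) (f a)) ^+ 2.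
have D0 : 0 < D by rewrite exprn_gt0 // cabs_gt0 // mob_den_neq0.
have E0 : 0 < E by rewrite exprn_gt0 // cabs_gt0 // mob_den_neq0.
rewrite ler_pdivlMr // mulrAC ler_pdivrMr // => H.
have E1 : (1 - enorm (f z)) ^+ 2 <= E.
  rewrite lerXn2r ?nnegrE ?cabs_ge0 ?subr_ge0 ?(ltW fz1) //.
  have := cabsD (1 - dotc (f z) (f a)) (dotc (f z) (f a)).
  rewrite subrK cabs1 => h; have := cauchy_schwarz (f z) (f a) => h2.
  have : enorm (f z) * enorm (f a) <= enorm (f z) by rewrite ler_piMr ?enorm_ge0 // ltW.
  lra.
move: hA; rewrite ler_pdivrMr ?subr_gt0 // => hA.
have A0 : 0 < A.
  have : 0 < A * (1 - enorm a) by apply: lt_le_trans hA; rewrite subr_gt0.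
  by rewrite pmulr_lgt0 // subr_gt0.
have p1 := enorm_ge0 (f z); have p2 := enorm_ge0 (f a); have p3 := enorm_ge0 a; have p4 := enorm_ge0 z.
set x := enorm (f z) in H E1 fz1 p1 *; set y := enorm (f a) in H fa1 hA p2.
set u := enorm a in H a1 hA p3; set v := enorm z in H z1 p4 *.
have v0 : 0 < 1 - v ^+ 2 by rewrite subr_gt0 expr_lt1.
have h1 : 1 - y ^+ 2 <= 2 * A * (1 - u ^+ 2).
  apply: le_trans (_ : 2 * (1 - y) <= _); first by nra.
  apply: le_trans (_ : 2 * (A * (1 - u)) <= _); first by lra.
  have : 0 <= A * (1 - u) * u by rewrite !mulr_ge0 ?subr_ge0 // ltW.
  nra.
have u0 : 0 < 1 - u ^+ 2 by rewrite subr_gt0 expr_lt1.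
have x0 : 0 < 1 - x by rewrite subr_gt0.
have h2 : (1 - u ^+ 2) * (1 - v ^+ 2) * (1 - x) ^+ 2 <=
   2 * A * (1 - u ^+ 2) * (1 - x ^+ 2) * D.
  apply: le_trans (_ : (1 - u ^+ 2) * (1 - v ^+ 2) * E <= _).
    by rewrite ler_pM2l // mulr_gt0.
  apply: le_trans H _; rewrite ler_pM2r // ler_pM2r // subr_gt0 expr_lt1 //.
have h3 : (1 - v ^+ 2) * (1 - x) ^+ 2 <= 2 * A * (1 - x ^+ 2) * D.
  by rewrite -(ler_pM2l u0); lra.
have h4 : (1 - v ^+ 2) * (1 - x) <= 2 * A * (1 + x) * D.
  by rewrite -(ler_pM2l x0); lra.
rewrite mulrC; apply: le_trans h4 _; rewrite ler_pM2r //.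
have : A * x <= A by rewrite ler_piMr // ltW.
lra.
Qed.

End Kobayashi.

(** * A quantitative open mapping theorem *)

Section DiffArith.
Variable R : realType.
Local Open Scope complex_scope.

Lemma mdiff_cst n m (c : 'rV[R[i]]_m) (z : 'rV[R[i]]_n) : mdiff (fun=> c) z 0.
Proof.
move=> e e0; exists 1 => // w _; rewrite mulmx0 subrr subr0 enorm0.
by rewrite mulr_ge0 ?enorm_ge0 // ltW.
Qed.

Lemma mdiff_affine m p (b : 'rV[R[i]]_p) (B : 'M[R[i]]_(m, p)) z :
  mdiff (fun w => b + w *m B) z B.
Proof.
move=> e e0; exists 1 => // w _.
by rewrite opprD addrACA subrr add0r mulmxBl subrr enorm0 mulr_ge0 ?enorm_ge0 // ltW.
Qed.

Lemma mdiffD n m (f g : 'rV[R[i]]_n -> 'rV[R[i]]_m) z A B :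
  mdiff f z A -> mdiff g z B -> mdiff (fun w => f w + g w) z (A + B).
Proof.
move=> hf hg e e0; have e20 : 0 < e / 2 by rewrite divr_gt0.
have [d1 d10 H1] := hf _ e20; have [d2 d20 H2] := hg _ e20.
exists (Num.min d1 d2); first by rewrite lt_min d10.
move=> w; rewrite lt_min => /andP[/H1 a /H2 b].
have -> : f w + g w - (f z + g z) - (w - z) *m (A + B) =
  (f w - f z - (w - z) *m A) + (g w - g z - (w - z) *m B).
  by rewrite mulmxDr !opprD (addrACA (f w)) [LHS]addrACA.
apply: le_trans (enormD _ _) _; lra.
Qed.

Lemma mdiffN n m (f : 'rV[R[i]]_n -> 'rV[R[i]]_m) z A :
  mdiff f z A -> mdiff (fun w => - f w) z (- A).
Proof.
move=> hf e e0; have [d d0 H] := hf _ e0; exists d => // w /H.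
by rewrite -enormN mulmxN !opprD.
Qed.

Lemma mdiff_shift n m (f : 'rV[R[i]]_n -> 'rV[R[i]]_m) z v A :
  mdiff f (z + v) A -> mdiff (fun w => f (w + v)) z A.
Proof.
move=> hf e e0; have [d d0 H] := hf _ e0; exists d => // w wz.
by have := H (w + v); rewrite opprD addrACA subrr addr0; apply.
Qed.
End DiffArith.

Section DetBounds.
Variable R : realType.
Local Open Scope complex_scope.

Lemma cabs_sign (b : bool) : cabs ((-1) ^+ b : R[i]) = 1.
Proof. by case: b; rewrite ?expr0 ?expr1 ?cabsN cabs1. Qed.

Lemma cabs_det_le n (A : 'M[R[i]]_n) :
  (forall i j, cabs (A i j) <= 1) -> cabs (\det A) <= n`!%:R.
Proof.
move=> hA; rewrite /determinant; apply: le_trans (ler_cabs_sum _ _ _) _.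
apply: le_trans (_ : \sum_(s : 'S_n) 1 <= _); last by rewrite sumr_const card_Sn.
apply: ler_sum => s _; rewrite cabsM cabs_sign mul1r.
elim/big_rec: _ => [|i x _ IH]; first by rewrite cabs1.
by rewrite cabsM mulr_ile1 ?cabs_ge0.
Qed.

(** Multiply v A by the adjugate, whose entries are bounded since they are minors
of A. *)
Lemma det_enorm_le n (A : 'M[R[i]]_n) (v : 'rV[R[i]]_n) :
  (forall i j, cabs (A i j) <= 1) ->
  cabs (\det A) * enorm v <= (n * (n * (n.-1)`!))%:R * enorm (v *m A).
Proof.
move=> hA; rewrite -enormZ -mul_mx_scalar -mul_mx_adj mulmxA.
apply: le_trans (enorm_mulmx_le _ _) _; rewrite ler_wpM2r ?enorm_ge0 //.
apply: le_trans (_ : \sum_(j < n) \sum_(k < n) (n.-1)`!%:R <= _).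
  apply: ler_sum => j _; apply: ler_sum => k _; rewrite mxE /cofactor cabsM.
  rewrite cabsX cabsN cabs1 expr1n mul1r; apply: cabs_det_le => i' j'.
  by rewrite !mxE.
by rewrite !sumr_const !card_ord -!mulrnA (mulnA n) (mulnC (n * n)%N).
Qed.
End DetBounds.

Section OpenMapping.
Variables (R : realType) (n : nat) (h : 'rV[R[i]]_n -> 'rV[R[i]]_n) (A : 'M[R[i]]_n).
Hypothesis hd : forall z, enorm z < 1 -> exists B, mdiff h z B.
Hypothesis hb : forall z, enorm z < 1 -> enorm (h z) <= 1.
Hypothesis h0 : h 0 = 0.
Hypothesis hA : mdiff h 0 A.
Local Open Scope complex_scope.

Lemma origin_contraction z : enorm z < 1 -> enorm (h z) <= enorm z.
Proof. by move=> z1; have := schwarz_lemma ltr01 hd hb h0 z1; rewrite mulr1 mul1r. Qed.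

(** The Schwarz lemma for w |-> h(p + w) - h(p) on the ball of radius 1/2. *)
Lemma lipschitz_half_ball p v : enorm p < 2^-1 -> enorm v < 2^-1 ->
  enorm (h (p + v) - h p) <= 4 * enorm v.
Proof.
move=> p1 v1; pose k w := h (w + p) + - h p.
have r0 : 0 < 2^-1 :> R by rewrite invr_gt0.
have wp w : enorm w < 2^-1 -> enorm (w + p) < 1 by move=> w1; have := enormD w p; lra.
have kd w : enorm w < 2^-1 -> exists B, mdiff k w B.
  move=> /wp /hd[B hB]; exists (B + 0); apply: mdiffD; first exact: mdiff_shift.
  exact: mdiff_cst.
have kb w : enorm w < 2^-1 -> enorm (k w) <= 2.
  move=> /wp /hb h1; apply: le_trans (enormD _ _) _; rewrite enormN.
  have := @hb p; lra.
have k0 : k 0 = 0 by rewrite /k add0r subrr.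
have := schwarz_lemma r0 kd kb k0 v1; rewrite /k (addrC v); lra.
Qed.

(** Replaces a bound on second derivatives: for fixed v the difference
h(w + v) - h(w) - h(v) is holomorphic in w, is O(|v|) by the Lipschitz estimate
and vanishes at w = 0, so that a second use of the Schwarz lemma gains |w|. *)
Lemma second_difference z v : enorm z < 2^-1 -> enorm v < 4^-1 ->
  enorm (h (z + v) - h z - h v) <= 10 * enorm v * enorm z.
Proof.
move=> z1 v1; pose k w := h (w + v) + - h w + - h v.
have r0 : 0 < 2^-1 :> R by rewrite invr_gt0.
have kd w : enorm w < 2^-1 -> exists B, mdiff k w B.
  move=> w1; have [|B hB] := @hd (w + v); first by have := enormD w v; lra.
  have [|C hC] := @hd w; first by lra.
  exists (B + - C + 0); apply: mdiffD; last exact: mdiff_cst.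
  by apply: mdiffD; [exact: mdiff_shift|exact: mdiffN].
have kb w : enorm w < 2^-1 -> enorm (k w) <= 5 * enorm v.
  move=> w1; apply: le_trans (enormD _ _) _; rewrite enormN.
  have hv : enorm v < 1 by lra.
  have hv2 : enorm v < 2^-1 by lra.
  have := origin_contraction hv; have := lipschitz_half_ball w1 hv2; lra.
have k0 : k 0 = 0 by rewrite /k add0r h0 subr0 subrr.
have := schwarz_lemma r0 kd kb k0 z1; rewrite /k; lra.
Qed.

(** By the second difference at v = w, doubling is linear up to O(|v|^2); the errors
of successive halvings form a geometric series. *)
Lemma dyadic_difference v m : enorm v < 2^-1 ->
  enorm (2 ^+ m *: h (2^-1 ^+ m *: v) - h v) <= 5 * enorm v ^+ 2 * (1 - 2^-1 ^+ m).
Proof.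
move=> v1; elim: m => [|m IH].
  by rewrite !expr0 !scale1r !subrr enorm0 mulr0.
set u := 2^-1 ^+ m.+1 *: v.
have half_norm (c : R[i]) : cabs (2^-1 * c) = 2^-1 * cabs c.
  by rewrite cabsM -real_half cabs_real ger0_norm // invr_ge0.
have hu : enorm u = 2^-1 ^+ m.+1 * enorm v.
  by rewrite enormZ cabsX -[2^-1]mulr1 half_norm cabs1 mulr1.
have Eu : 2^-1 ^+ m *: v = u + u.
  by rewrite /u -scalerDl exprS; congr (_ *: _); field.
have q0 : 0 < (2^-1 : R) ^+ m by rewrite exprn_gt0.
have q1 : (2^-1 : R) ^+ m <= 1 by apply: exprn_ile1; lra.
have nv := enorm_ge0 v.
have u4 : enorm u < 4^-1.
  rewrite hu exprS; apply: le_lt_trans (_ : 2^-1 * enorm v < _); last lra.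
  by rewrite -mulrA ler_pM2l // ler_piMl.
have u2 : enorm u < 2^-1 by lra.
have := second_difference u2 u4.
have -> : h (u + u) - h u - h u = h (2^-1 ^+ m *: v) - 2 *: h u.
  by rewrite Eu scaler_nat mulr2n opprD addrA.
move=> h1.
have -> : 2 ^+ m.+1 *: h u - h v = (2 ^+ m *: h (2^-1 ^+ m *: v) - h v)
    - 2 ^+ m *: (h (2^-1 ^+ m *: v) - 2 *: h u).
  by rewrite scalerBr scalerA -exprSr opprB [RHS]addrC addrA subrK.
apply: le_trans (enormD _ _) _; rewrite enormN enormZ.
have -> : cabs (2 ^+ m : R[i]) = 2 ^+ m.
  by rewrite cabsX -(rmorph_nat (real_complex R)) /= cabs_real ger0_norm.
have h2 : 2 ^+ m * enorm (h (2^-1 ^+ m *: v) - 2 *: h u) <=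
    2 ^+ m * (10 * enorm u * enorm u) by rewrite ler_pM2l // exprn_gt0.
have E : 2 ^+ m * (10 * enorm u * enorm u) = 5 * enorm v ^+ 2 * (2^-1 * 2^-1 ^+ m).
  rewrite hu exprS.
  have -> : 2 ^+ m * (10 * (2^-1 * 2^-1 ^+ m * enorm v) * (2^-1 * 2^-1 ^+ m * enorm v)) =
    (2 * 2^-1) ^+ m * (2^-1 ^+ m) * 10 * 2^-1 * 2^-1 * enorm v ^+ 2 by rewrite exprMn; ring.
  by rewrite mulfV // expr1n; field.
rewrite E in h2; apply: le_trans (lerD IH h2) _.
by rewrite (exprS 2^-1) -mulrDr ler_wpM2l ?mulr_ge0 ?sqr_ge0 //; lra.
Qed.

(** The dyadic quotients 2^m h(v / 2^m) tend to v A. *)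
Lemma linear_approx v : enorm v < 2^-1 -> enorm (h v - v *m A) <= 5 * enorm v ^+ 2.
Proof.
move=> v1; apply/ler_addgt0Pr => e e0.
have [d d0 Hd] := hA e0.
have [m Xm] : exists m : nat, d^-1 < 2 ^+ m.
  by apply: exists_pow2_gt; rewrite invr_ge0 ltW.
have m2 : (0 : R) < 2 ^+ m by rewrite exprn_gt0.
have q0 : 0 < (2^-1 : R) ^+ m by rewrite exprn_gt0.
have dm : 2^-1 ^+ m < d by rewrite exprVn invf_plt ?posrE.
have nv := enorm_ge0 v.
set u := 2^-1 ^+ m *: v.
have hu : enorm u = 2^-1 ^+ m * enorm v.
  rewrite enormZ cabsX -[2^-1]mulr1 cabsM -real_half cabs_real ger0_norm ?invr_ge0 //.
  by rewrite cabs1 mulr1.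
have ud : enorm (u - 0) < d.
  rewrite subr0 hu; apply: le_lt_trans dm; rewrite ler_piMr ?(ltW q0) //; lra.
have := Hd _ ud; rewrite h0 !subr0 => h1.
have := dyadic_difference m v1; rewrite -/u => h2.
have -> : h v - v *m A = - (2 ^+ m *: h u - h v) + 2 ^+ m *: (h u - u *m A).
  have -> : 2 ^+ m *: (h u - u *m A) = 2 ^+ m *: h u - v *m A.
    rewrite scalerBr /u -scalemxAl scalerA -exprMn mulfV ?expr1n ?scale1r ?pnatr_eq0 //.
  by rewrite opprB addrA subrK.
apply: le_trans (enormD _ _) _; rewrite enormN enormZ.
have -> : cabs (2 ^+ m : R[i]) = 2 ^+ m.
  by rewrite cabsX -(rmorph_nat (real_complex R)) /= cabs_real ger0_norm.
apply: lerD.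
  by apply: le_trans h2 _; rewrite ler_piMr ?mulr_ge0 ?sqr_ge0 //; lra.
apply: le_trans (ler_wpM2l (ltW m2) h1) _.
rewrite hu (_ : 2 ^+ m * _ = e * enorm v * (2 * 2^-1) ^+ m); last by rewrite exprMn; ring.
rewrite mulfV ?pnatr_eq0 // expr1n mulr1 ler_piMr ?(ltW e0) //; lra.
Qed.

Lemma increment_approx w v : enorm w < 2^-1 -> enorm v < 4^-1 ->
  enorm (h (w + v) - h w - v *m A) <= (10 * enorm w + 5 * enorm v) * enorm v.
Proof.
move=> w1 v1.
have -> : h (w + v) - h w - v *m A = (h (w + v) - h w - h v) + (h v - v *m A).
  by rewrite addrA subrK.
apply: le_trans (enormD _ _) _.
have v2 : enorm v < 2^-1 by have := enorm_ge0 v; lra.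
have := second_difference w1 v1; have := linear_approx v2; lra.
Qed.

(** The differential inherits the contraction property |h(v)| <= |v| by scaling v to
0. *)
Lemma linear_part_le v : enorm (v *m A) <= enorm v.
Proof.
apply/ler_addgt0Pr => e e0; have nv := enorm_ge0 v.
pose N := enorm v + 1; have N0 : 0 < N by rewrite ltr_wpDl.
pose t := Num.min (2^-1 / N) (e / (5 * N ^+ 2)) / 2.
have m0 : 0 < Num.min (2^-1 / N) (e / (5 * N ^+ 2)).
  by rewrite lt_min !divr_gt0 // mulr_gt0 // exprn_gt0.
have t0 : 0 < t by rewrite divr_gt0.
have t1 : t < 2^-1 / N.
  by apply: lt_le_trans (_ : Num.min (2^-1 / N) (e / (5 * N ^+ 2)) <= _); [rewrite /t; lra|rewrite ge_min lexx].
have t2 : t <= e / (5 * N ^+ 2).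
  by apply: le_trans (_ : Num.min (2^-1 / N) (e / (5 * N ^+ 2)) <= _); [rewrite /t; lra|rewrite ge_min lexx orbT].
have nu : enorm (t%:C *: v) = t * enorm v by rewrite enormZ cabs_real ger0_norm // ltW.
have vN : enorm v <= N by rewrite /N lerDl.
have u1 : enorm (t%:C *: v) < 2^-1.
  rewrite nu; apply: le_lt_trans (_ : t * N < _); first by rewrite ler_pM2l.
  by rewrite -ltr_pdivlMr.
have u1' : enorm (t%:C *: v) < 1 by lra.
have a1 := linear_approx u1; have a2 := origin_contraction u1'.
have : enorm (t%:C *: v *m A) <= t * enorm v + 5 * (t * enorm v) ^+ 2.
  have -> : t%:C *: v *m A = h (t%:C *: v) - (h (t%:C *: v) - t%:C *: v *m A) by rewrite subKr.
  by apply: le_trans (enormD _ _) _; rewrite enormN -nu; apply: lerD.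
rewrite -scalemxAl enormZ cabs_real ger0_norm ?(ltW t0) // => a3.
have : enorm (v *m A) <= enorm v + 5 * t * enorm v ^+ 2.
  by rewrite -(ler_pM2l t0); lra.
move=> a4; apply: le_trans a4 _; rewrite lerD2l.
apply: le_trans (_ : 5 * t * N ^+ 2 <= _).
  apply: ler_wpM2l; first by rewrite mulr_ge0 // ltW.
  by rewrite ler_pXn2r ?nnegrE // ltW.
by move: t2; rewrite ler_pdivlMr ?mulr_gt0 ?exprn_gt0 //; lra.
Qed.

Lemma linear_part_entry i j : cabs (A i j) <= 1.
Proof.
have -> : A i j = ((delta_mx ord0 i : 'rV[R[i]]_n) *m A) ord0 j by rewrite -rowE mxE.
apply: le_trans (cabs_coord _ _) _; apply: le_trans (linear_part_le _) _.
rewrite /enorm (bigD1 i) //= big1 => [|k ki].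
  by rewrite mxE !eqxx cabs1 expr1n addr0 sqrtr1.
by rewrite mxE (negbTE ki) andbF cabs0 expr0n.
Qed.

(** The function |h(z) - y| + k |z| attains its minimum on a small closed ball.  If
h(z) <> y there, one Newton step with the fixed linear part A divides |h(z) - y|
by at least 4 while increasing k |z| by at most a quarter of it, against
minimality.  The term k |z| keeps the minimum near the centre, so that the step
stays in the domain. *)
Theorem open_mapping (m0 : R) : 0 < m0 -> m0 <= 1 ->
  (forall v, m0 * enorm v <= enorm (v *m A)) -> A \in unitmx ->
  forall y, enorm y < m0 ^+ 2 / 180 -> exists2 z, enorm z < 1 & h z = y.
Proof.
move=> m00 m01 hm Au y hy.
have m2 : m0 ^+ 2 <= m0 by rewrite expr2 ler_piMl // ltW.
(* Radius 1/8 keeps z within reach of the increment estimate after a step. *)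
pose k := m0 / 4.
pose F z := enorm (h z - y) + k * enorm z.
have k0 : 0 < k by rewrite divr_gt0.
have r0 : 0 <= 8^-1 :> R by rewrite invr_ge0.
have [|z hz Hz] := @closed_ball_min R n F 8^-1 r0.
  move=> z hz e e0; exists (Num.min 4^-1 (e / (5 + k))).
    by rewrite lt_min invr_gt0 ltr0n divr_gt0 // addr_gt0.
  move=> w hw; rewrite lt_min => /andP[d1 d2].
  have E : w = z + (w - z) by rewrite addrC subrK.
  have L : enorm (h w - h z) <= 4 * enorm (w - z).
    by rewrite {1}E; apply: lipschitz_half_ball; lra.
  have a1 := enorm_dist (h w - y) (h z - y).
  rewrite opprB addrA subrK in a1.
  have a2 := enorm_dist w z.
  have a3 : `|k * enorm w - k * enorm z| <= k * enorm (w - z).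
    by rewrite -mulrBr normrM (gtr0_norm k0) ler_pM2l.
  apply: le_lt_trans (_ : (5 + k) * enorm (w - z) < e); last first.
    by rewrite mulrC -ltr_pdivlMr // addr_gt0.
  rewrite /F opprD addrACA; apply: le_trans (ler_normD _ _) _.
  have := enorm_ge0 (w - z); lra.
exists z; first lra.
have Fz : F z <= enorm y.
  have := Hz 0; rewrite enorm0 => /(_ r0); rewrite /F h0 sub0r enormN enorm0 mulr0 addr0.
  by [].
apply: contrapT => hzy.
have q0 : 0 < enorm (h z - y).
  by apply: enorm_gt0; apply/negP; rewrite subr_eq0 => /eqP.
set q := h z - y in q0 Fz *.
have ny := enorm_ge0 y; have nz := enorm_ge0 z.
have kz : k * enorm z <= enorm y by move: Fz; rewrite /F -/q; lra.
have qy : enorm q <= enorm y.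
  have kz0 : 0 <= k * enorm z by rewrite mulr_ge0 // ltW.
  by move: Fz; rewrite /F -/q; lra.
pose v := - (q *m invmx A).
have vA : v *m A = - q by rewrite /v mulNmx mulmxKV.
have mv : m0 * enorm v <= enorm q by rewrite -(enormN q) -vA.
have nv := enorm_ge0 v.
have mz : m0 * enorm z <= 4 * enorm y by move: kz; rewrite /k; lra.
(* b bounds the step; 180 = 4 (10 * 4 + 5) makes the error at most a quarter. *)
pose b := m0 / 180.
have hb' : m0 * b = m0 ^+ 2 / 180 by rewrite /b; ring.
have zb : enorm z <= 4 * b by rewrite -(ler_pM2l m00); lra.
have vb : enorm v <= b by rewrite -(ler_pM2l m00); lra.
have b1 : b <= 180^-1 by rewrite /b; lra.
have z1 : enorm z < 2^-1 by lra.
have v1 : enorm v < 4^-1 by lra.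
have zv : enorm (z + v) <= 8^-1 by have := enormD z v; lra.
have app := increment_approx z1 v1.
rewrite vA opprK in app.
have E : h (z + v) - y = h (z + v) - h z + q by rewrite /q addrA subrK.
have f1 : enorm (h (z + v) - y) <= enorm q / 4.
  rewrite E; apply: le_trans app _.
  apply: le_trans (_ : 45 * b * enorm v <= _).
    by rewrite ler_wpM2r //; lra.
  by rewrite /b; lra.
have f2 : k * enorm (z + v) <= k * enorm z + enorm q / 4.
  apply: le_trans (_ : k * (enorm z + enorm v) <= _).
    by rewrite ler_pM2l // enormD.
  by rewrite mulrDr lerD2l /k; lra.
have := Hz _ zv; rewrite /F -/q; lra.
Qed.

End OpenMapping.

(** * Estimates at the boundary fixed point *)

Section BoundaryEstimates.
Variables (R : realType) (n : nat).
Implicit Types (f : 'rV[R[i]]_n.+1 -> 'rV[R[i]]_n.+1) (zeta : R[i]) (M s : R).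
Local Open Scope complex_scope.
Local Notation e1 := (e1 R n).

Lemma enorm_e1 : enorm e1 = 1.
Proof.
rewrite /enorm (bigD1 ord0) //= big1 => [|k k0].
  by rewrite mxE !eqxx cabs1 expr1n addr0 sqrtr1.
by rewrite mxE (negbTE k0) andbF cabs0 expr0n.
Qed.

Lemma enorm_Ze1 zeta : enorm (zeta *: e1) = cabs zeta.
Proof. by rewrite enormZ enorm_e1 mulr1. Qed.

Lemma dotc_Ze1 zeta : dotc (zeta *: e1) e1 = zeta.
Proof. by rewrite dotcZl dotc_self enorm_e1 expr1n mulr1. Qed.

Lemma nbhs_enorm m (p : 'rV[R[i]]_m) (e : R) : 0 < e ->
  nbhs p [set z | enorm (z - p) < e].
Proof.
move=> e0; apply/nbhs_ballP; exists (e / m.+1%:R)%:C => /=.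
  by rewrite ltcR divr_gt0.
move=> z; rewrite -ball_normE /= => h.
rewrite enormB -ltcR; apply: le_lt_trans (enorm_le_sup_norm _) _.
by move: h; rewrite real_complexM real_complexV rmorph_nat ltr_pdivlMr // mulrC.
Qed.

(** The finiteness of the lower limit provides points tending to e_1 at which the
quotient stays below a constant. *)
Lemma regular_points f : boundary_regular_fixed_point f ->
  exists A : R, forall e : R, 0 < e -> exists a,
    [/\ enorm a < 1, enorm (a - e1) < e & (1 - enorm (f a)) / (1 - enorm a) <= A].
Proof.
move=> [+ _]; rewrite limf_einfE; set S := ereal_sup _ => Sfin.
have [A SA] : exists A : R, (S < A%:E)%E.
  move: Sfin; case: S => [r|//|] _; last by exists 0; rewrite ltNyr.
  by exists (r + 1); rewrite lte_fin ltrDl.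
exists A => e e0.
set V := [set z | unit_ball z /\ enorm (z - e1) < e].
have VF : within (@unit_ball R n.+1) (nbhs e1) V.
  by apply: filterS (nbhs_enorm e1 e0) => z ze zb; split.
have : (ereal_inf [set ((1 - enorm (f z)) / (1 - enorm z))%:E | z in V] < A%:E)%E.
  by apply: le_lt_trans SA; apply: ereal_sup_ubound; exists V.
move=> /ereal_inf_lt[_ [a [/unit_ballE a1 ae] <-]]; rewrite lte_fin => /ltW h.
by exists a; split.
Qed.

(** Apply [julia_inequality] with a at distance less than |1 - zeta| from e_1, and
use that |1 - zeta| <= M (1 - |zeta|) in the Stolz angle. *)
Lemma julia_stolz f M : holomorphic_self_map f -> boundary_regular_fixed_point f -> 0 < M ->
  exists2 C : R, 0 < C & forall zeta s, stolz_angle M s zeta ->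
    1 - enorm (f (zeta *: e1)) <= C * (1 - cabs zeta).
Proof.
move=> hf /regular_points[A HA] M0.
have A0 : 0 < A.
  have [a [a1 _ h]] := HA 1 ltr01.
  have [_ fb] := (holomorphic_self_mapP f).1 hf.
  by apply: lt_le_trans h; rewrite divr_gt0 // subr_gt0 // fb.
exists (16 * A * M ^+ 2); first by rewrite !mulr_gt0 // exprn_gt0.
move=> zeta s [z1 zM _].
have z0 : 0 < 1 - cabs zeta by rewrite subr_gt0.
have t0 : 0 < cabs (1 - zeta).
  by have := cabsD (1 - zeta) zeta; rewrite subrK cabs1; lra.
have [a [a1 ae h]] := HA _ t0.
have ez1 : enorm (zeta *: e1) < 1 by rewrite enorm_Ze1.
have J := julia_inequality hf a1 ez1 h.
have D : cabs (1 - dotc (zeta *: e1) a) <= 2 * cabs (1 - zeta).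
  have -> : 1 - dotc (zeta *: e1) a = (1 - zeta) - dotc (zeta *: e1) (a - e1).
    by rewrite dotcDr dotcNr dotc_Ze1; ring.
  apply: le_trans (cabsD _ _) _; rewrite cabsN mulr_natl mulr2n lerD2l.
  apply: le_trans (cauchy_schwarz _ _) _; rewrite enorm_Ze1.
  by apply: le_trans (ler_piMl (enorm_ge0 _) (ltW z1)) (ltW ae).
have zM' : cabs (1 - zeta) <= M * (1 - cabs zeta).
  by move: zM; rewrite ltr_pdivrMr // => /ltW.
rewrite enorm_Ze1 in J.
set x := cabs zeta in z1 z0 zM' J *; set t := cabs (1 - zeta) in t0 D zM' *.
set y := 1 - enorm _ in J *; set d := cabs (1 - dotc _ _) in D J.
have x0 : 0 <= x := cabs_ge0 _.
have d2 : d ^+ 2 <= (2 * (M * (1 - x))) ^+ 2.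
  have d1 : d <= 2 * (M * (1 - x)) by lra.
  have d0 : 0 <= d := cabs_ge0 _.
  by rewrite ler_pXn2r ?nnegrE // (le_trans d0 d1).
have y0 : 0 <= y.
  have [_ fb] := (holomorphic_self_mapP f).1 hf.
  by rewrite subr_ge0 ltW // fb.
have : y * (1 - x) <= 4 * A * (2 * (M * (1 - x))) ^+ 2.
  apply: le_trans (_ : y * (1 - x ^+ 2) <= _).
    by rewrite ler_wpM2l // lerD2l lerN2 expr2 ler_piMl // ltW.
  by apply: le_trans J _; rewrite ler_pM2l // mulr_gt0.
have -> : 4 * A * (2 * (M * (1 - x))) ^+ 2 = 16 * A * M ^+ 2 * (1 - x) * (1 - x) by ring.
by rewrite ler_pM2r.
Qed.

(** Otherwise there is a sequence in the Stolz angle tending to 1 along which the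
determinant is below c/2, contradicting the lower limit. *)
Lemma super_regular_det f M : boundary_super_regular_fixed_point f -> 1 < M ->
  exists c s0 : R, [/\ 0 < c, 0 < s0 & forall zeta, stolz_angle M s0 zeta ->
    c <= cabs (\det (jacobian f (zeta *: e1)))].
Proof.
move=> [_ H] M1; have [c c0 Hc] := H M M1.
exists (c / 2); apply: contrapT => no.
have c20 : 0 < c / 2 by rewrite divr_gt0.
have /choice[zeta Hz] : forall k : nat, exists zeta : R[i],
    stolz_angle M k.+1%:R^-1 zeta /\ cabs (\det (jacobian f (zeta *: e1))) < c / 2.
  move=> k; apply: contrapT => nok; apply: no; exists k.+1%:R^-1; split => //.
  move=> zeta hz; rewrite leNgt; apply/negP => h; apply: nok; by exists zeta.
have S2 k : stolz_angle M 2 (zeta k).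
  have [[a b d] _] := Hz k; split => //; apply: lt_trans d _.
  by apply: le_lt_trans (_ : 1 < 2); [rewrite invf_le1 ?ler1n|rewrite ltr1n].
have cv : zeta k @[k --> \oo] --> (1 : R[i]).
  apply/cvgrPdist_lt => e e0; have [x x0 ->] := gt0_real e0.
  pose X : R := x^-1; exists (Num.bound X) => // k /= hk.
  rewrite cabsE ltcR; have [[_ _ d] _] := Hz k; apply: lt_trans d _.
  rewrite invf_plt ?posrE //; apply: lt_le_trans (archi_boundP _) _.
    by rewrite invr_ge0 ltW.
  by rewrite ler_nat leqW.
have := Hc _ S2 cv; rewrite /limn_einf -/(limf_einf _ _) limf_einfE => h.
have : (c%:E <= (c / 2)%:E)%E.
  apply: le_trans h _; apply: ge_ereal_sup => _ [V VF <-].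
  have [k Vk] := filter_ex VF.
  apply: le_trans (_ : (cabs (\det (jacobian f (zeta k *: e1))))%:E <= _)%E.
    by apply: ereal_inf_lbound; exists k.
  by rewrite lee_fin; have [_ /ltW] := Hz k.
by rewrite lee_fin; lra.
Qed.

End BoundaryEstimates.

(** * Rescaled charts along a Stolz angle *)

Section StolzCharts.
Variables (R : realType) (n : nat).
Local Open Scope complex_scope.
Local Notation e1 := (e1 R n).

(** The lower bound on the determinant bounds A from below as a linear map, through
[det_enorm_le]; the entries of A are at most 1 by the Schwarz lemma. *)
Lemma open_mapping_det (h : 'rV[R[i]]_n.+1 -> 'rV[R[i]]_n.+1) (A : 'M[R[i]]_n.+1) (c : R) :
  0 < c ->
  let m0 := Num.min 1 (c / ((n.+1 * (n.+1 * n`!))%:R + 1)) in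
  (forall z, enorm z < 1 -> exists B, mdiff h z B) ->
  (forall z, enorm z < 1 -> enorm (h z) <= 1) -> h 0 = 0 -> mdiff h 0 A ->
  c <= cabs (\det A) ->
  forall y, enorm y < m0 ^+ 2 / 180 -> exists2 z, enorm z < 1 & h z = y.
Proof.
move=> c0 m0 hd hb h0 hA cA.
set K : R := (n.+1 * (n.+1 * n`!))%:R.
have K0 : 0 < K + 1 by rewrite ltr_wpDl.
have m00 : 0 < m0 by rewrite lt_min ltr01 divr_gt0.
have m01 : m0 <= 1 by rewrite ge_min lexx.
have mK : m0 * (K + 1) <= c by rewrite -ler_pdivlMr // ge_min lexx orbT.
apply: (open_mapping hd hb h0 hA m00 m01) => [v|]; last first.
  by rewrite unitmxE unitfE; apply/negP => /eqP E; move: cA; rewrite E cabs0; lra.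
have := det_enorm_le v (linear_part_entry hd hb h0 hA); rewrite -/K => h1.
have nv := enorm_ge0 v; have nA := enorm_ge0 (v *m A).
rewrite -(ler_pM2r K0) mulrAC.
apply: le_trans (_ : c * enorm v <= _); first by rewrite ler_wpM2r.
apply: le_trans (_ : cabs (\det A) * enorm v <= _); first by rewrite ler_wpM2r.
by apply: le_trans h1 _; rewrite mulrC ler_wpM2l // lerDl.
Qed.

Lemma one_sub_sqr_le (x k : R) : 1 - x <= k -> 1 - x ^+ 2 <= 2 * k.
Proof. by move=> h; nra. Qed.

(** The shape of Kobayashi balls near a boundary point: size d in the complex normal
direction, sqrt(d) in the complex tangential ones. *)
Definition stolz_scaling (d : R) : 'rV[R[i]]_n.+1 :=
  \row_j (if j == ord0 then d / 2 else Num.sqrt d / 2)%:C.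

Definition stolz_chart (zeta : R[i]) (z : 'rV[R[i]]_n.+1) :=
  zeta *: e1 + z *m diag_mx (stolz_scaling (1 - cabs zeta)).

(** The power n + 2 of sqrt(d) is exactly the one by which the Jacobian determinant
of the target involution blows up. *)
Lemma det_stolz_scaling d : 0 <= d ->
  cabs (\det (diag_mx (stolz_scaling d))) = Num.sqrt d ^+ n.+2 / 2 ^+ n.+1.
Proof.
move=> d0; rewrite det_diag big_ord_recl cabsM mxE eqxx cabs_real.
rewrite ger0_norm ?divr_ge0 //.
have -> : \prod_(j < n) stolz_scaling d ord0 (lift ord0 j) = (Num.sqrt d / 2)%:C ^+ n.
  rewrite (eq_bigr (fun=> (Num.sqrt d / 2)%:C)) ?prodr_const ?card_ord // => j _.
  by rewrite mxE.
rewrite cabsX cabs_real ger0_norm ?divr_ge0 ?sqrtr_ge0 //.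
rewrite -{1}(sqr_sqrtr d0) expr_div_n !exprS; field.
by rewrite expf_neq0.
Qed.

(** With d = 1 - |zeta| the square of the norm is at most
(1 - d/2)^2 + d/4 = 1 - 3d/4 + d^2/4. *)
Lemma stolz_chart_ball zeta z : cabs zeta < 1 -> enorm z < 1 ->
  enorm (stolz_chart zeta z) < 1.
Proof.
move=> t1 z1; set d := 1 - cabs zeta.
have d0 : 0 < d by rewrite subr_gt0.
have d1 : d <= 1 by rewrite lerBlDr lerDl cabs_ge0.
rewrite -(@ltr_pXn2r _ 2) ?nnegrE ?enorm_ge0 // expr1n enorm_sqr (bigD1 ord0) //=.
have E0 : cabs (stolz_chart zeta z ord0 ord0) <= cabs zeta + d / 2.
  rewrite /stolz_chart mul_mx_diag mxE mxE mxE eqxx mulr1 mxE mxE eqxx -/d.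
  apply: le_trans (cabsD _ _) _; rewrite lerD2l cabsM cabs_real ger0_norm; last lra.
  rewrite ler_piMl //; first lra.
  by apply: le_trans (cabs_coord _ _) _; exact: ltW.
have Ej j : j != ord0 -> cabs (stolz_chart zeta z ord0 j) ^+ 2 = d / 4 * cabs (z ord0 j) ^+ 2.
  move=> j0; rewrite /stolz_chart mul_mx_diag mxE mxE mxE (negbTE j0) andbF mulr0 add0r.
  rewrite mxE mxE (negbTE j0) -/d cabsM cabs_real ger0_norm; last first.
    by rewrite divr_ge0 ?sqrtr_ge0.
  by rewrite exprMn expr_div_n sqr_sqrtr ?(ltW d0) //; field.
rewrite (eq_bigr _ Ej) -mulr_sumr.
have S1 : \sum_(j < n.+1 | j != ord0) cabs (z ord0 j) ^+ 2 <= 1.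
  apply: le_trans (_ : enorm z ^+ 2 <= _).
    by rewrite enorm_sqr [leRHS](bigD1 ord0) //= lerDr sqr_ge0.
  by rewrite expr_le1 ?enorm_ge0 // ltW.
apply: le_lt_trans (_ : (cabs zeta + d / 2) ^+ 2 + d / 4 * 1 < _).
  apply: lerD.
    by rewrite ler_pXn2r ?nnegrE ?cabs_ge0 // addr_ge0 ?cabs_ge0 // divr_ge0 // ltW.
  by rewrite ler_wpM2l // divr_ge0 // ltW.
have E : cabs zeta = 1 - d by rewrite /d; ring.
by rewrite E; nra.
Qed.

Lemma stolz_chart_near zeta z s : 0 < s -> s < 1 -> cabs zeta < 1 -> cabs (1 - zeta) < s ->
  enorm z < 1 -> enorm (stolz_chart zeta z - e1) < 2 * Num.sqrt s.
Proof.
move=> s0 s1 t1 ts z1; set d := 1 - cabs zeta.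
have d0 : 0 < d by rewrite subr_gt0.
have ds : d < s.
  by apply: le_lt_trans ts; have := cabsD (1 - zeta) zeta; rewrite subrK cabs1 /d; lra.
have q0 := sqrtr_ge0 s; have q2 := sqr_sqrtr (ltW s0).
have p0 := sqrtr_ge0 d; have p2 := sqr_sqrtr (ltW d0).
have q1 : Num.sqrt s < 1 by rewrite -[ltRHS]sqrtr1 ltr_sqrt.
have pq : Num.sqrt d < Num.sqrt s by rewrite ltr_sqrt.
have -> : stolz_chart zeta z - e1 = - (1 - zeta) *: e1 + z *m diag_mx (stolz_scaling d).
  by rewrite /stolz_chart addrAC -[X in _ - X + _]scale1r -scalerBl opprB.
apply: le_lt_trans (enormD _ _) _; rewrite enormZ cabsN enorm_e1 mulr1.
have Z : enorm (z *m diag_mx (stolz_scaling d)) <= Num.sqrt d / 2 * enorm z.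
  rewrite -(@ler_pXn2r _ 2) ?nnegrE ?mulr_ge0 ?enorm_ge0 ?divr_ge0 //.
  rewrite exprMn !enorm_sqr mulr_sumr; apply: ler_sum => j _.
  rewrite mul_mx_diag mxE cabsM mulrC exprMn ler_wpM2r ?sqr_ge0 //.
  rewrite mxE cabs_real real_normK ?num_real //.
  rewrite ler_pXn2r ?nnegrE ?divr_ge0 //; last by case: ifP => _; rewrite divr_ge0 // ltW.
  case: ifP => _ //; rewrite ler_pM2r ?invr_gt0 //; nra.
have h2 : s <= Num.sqrt s by nra.
have := enorm_ge0 z; nra.
Qed.

End StolzCharts.

Theorem theorem2p11 (R : realType) (n : nat)
  (f : 'rV[R[i]]_n.+1 -> 'rV[R[i]]_n.+1) :
  holomorphic_self_map f ->
  boundary_super_regular_fixed_point f ->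
  forall eta M : R, 0 < eta -> 1 < M ->
  exists s r : R, [/\ 0 < s, s < 1, 0 < r &
    \bigcup_(zeta in stolz_angle M s) kobayashi_ball (f (zeta *: e1 R n)) r
      `<=` f @` (@unit_ball R n.+1 `&` eball (e1 R n) eta)].
Proof.
move=> hf hsr eta M eta0 M1.
have M0 : 0 < M by lra.
have [C C0 HC] := julia_stolz hf hsr.1 M0.
have [c [s0 [c0 s00 Hdet]]] := super_regular_det hsr M1.
have [fd fb] := (holomorphic_self_mapP f).1 hf.
pose s : R := Num.min 2^-1 (Num.min s0 ((eta / 2) ^+ 2)).
have sgt0 : 0 < s.
  by rewrite !lt_min invr_gt0 ltr0n s00 exprn_gt0 // divr_gt0.
have s1 : s < 1 by rewrite gt_min; apply/orP; left; lra.
have ss0 : s <= s0 by rewrite !ge_min lexx orbT.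
have ss2 : s <= (eta / 2) ^+ 2 by rewrite !ge_min lexx !orbT.
have seta : 2 * Num.sqrt s <= eta.
  have : Num.sqrt s <= eta / 2.
    by rewrite -[leRHS]ger0_norm ?divr_ge0 ?(ltW eta0) // -sqrtr_sqr ler_wsqrtr.
  lra.
(* b bounds sqrt(1 - |zeta|) / sqrt(1 - |w|^2) from below. *)
pose b : R := (Num.sqrt (2 * C))^-1.
have b0 : 0 < b by rewrite invr_gt0 sqrtr_gt0 mulr_gt0.
pose c1 : R := b ^+ n.+2 / 2 ^+ n.+1 * c.
have c10 : 0 < c1 by rewrite mulr_gt0 // divr_gt0 // exprn_gt0.
pose m0 : R := Num.min 1 (c1 / ((n.+1 * (n.+1 * n`!))%:R + 1)).
have m00 : 0 < m0.
  by rewrite lt_min ltr01 divr_gt0 // ltr_wpDl.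
have m01 : m0 <= 1 by rewrite ge_min lexx.
pose rho := m0 ^+ 2 / 180.
have rho0 : 0 < rho by rewrite divr_gt0 // exprn_gt0.
have rho1 : rho < 1.
  have : m0 ^+ 2 <= 1 by rewrite expr_le1 // ltW.
  by rewrite /rho; lra.
exists s, (artanh rho); split => //; first exact: artanh_gt0.
move=> y [zeta hz hy].
have [z1 zM zs] := hz.
have ez1 : enorm (zeta *: e1 R n) < 1 by rewrite enorm_Ze1.
set w := f (zeta *: e1 R n) in hy.
have w1 : enorm w < 1 by exact: fb.
have [y1 yr] := kobayashi_ball_mob w1 rho0 rho1 hy.
pose P := @stolz_chart R n zeta.
have P0 : P 0 = zeta *: e1 R n by rewrite /P /stolz_chart mul0mx addr0.
have Pd z : mdiff P z (diag_mx (stolz_scaling n (1 - cabs zeta))) by exact: mdiff_affine.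
have hfd : mdiff f (P 0) (jacobian f (zeta *: e1 R n)).
  by rewrite P0; apply: differentiable_mdiff; apply: hf.1; apply/unit_ballE.
pose h := mob w \o (f \o P).
have hd z : enorm z < 1 -> exists B, mdiff h z B.
  move=> zz; have Pz : enorm (P z) < 1 by exact: stolz_chart_ball.
  have [B hB] := fd _ Pz.
  exists (diag_mx (stolz_scaling n (1 - cabs zeta)) *m B *m mob_diff w (f (P z))).
  apply: mdiff_comp; first exact: mdiff_comp.
  by apply: mob_mdiff => //; exact: fb.
have hb z : enorm z < 1 -> enorm (h z) <= 1.
  move=> zz; apply: ltW; apply: mob_ball => //; apply: fb; exact: stolz_chart_ball.
have h0 : h 0 = 0 by rewrite /h /comp P0 mob_center.
have hA : mdiff h 0 (diag_mx (stolz_scaling n (1 - cabs zeta)) *m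
    jacobian f (zeta *: e1 R n) *m mob_diff w w).
  apply: mdiff_comp; first exact: mdiff_comp.
  by rewrite /comp P0 -/w; exact: mob_mdiff.
have d0 : 0 < 1 - cabs zeta by rewrite subr_gt0.
have cA : c1 <= cabs (\det (diag_mx (stolz_scaling n (1 - cabs zeta)) *m
    jacobian f (zeta *: e1 R n) *m mob_diff w w)).
  rewrite !det_mulmx !cabsM det_stolz_scaling ?(ltW d0) // det_mob_diff //.
  have sw0 := mob_s_gt0 w1.
  have cJ : c <= cabs (\det (jacobian f (zeta *: e1 R n))).
    by apply: Hdet; split => //; exact: lt_le_trans zs ss0.
  set d := 1 - cabs zeta in d0 *; set J := cabs (\det (jacobian _ _)) in cJ *.
  have bs : b <= Num.sqrt d * (mob_s w)^-1.
    rewrite /b ler_pdivlMr // mulrC -[leRHS]mulr1; rewrite ler_pdivrMr ?sqrtr_gt0 ?mulr_gt0 //.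
    rewrite mulr1 -sqrtrM ?(ltW d0) // /mob_s ler_wsqrtr //.
    rewrite (_ : d * (2 * C) = 2 * (C * d)); last by ring.
    exact: (one_sub_sqr_le (HC _ _ hz)).
  have -> : Num.sqrt d ^+ n.+2 / 2 ^+ n.+1 * J * (mob_s w)^-1 ^+ n.+2 =
    (Num.sqrt d * (mob_s w)^-1) ^+ n.+2 / 2 ^+ n.+1 * J by rewrite exprMn; ring.
  apply: ler_pM => //; rewrite ?(ltW c0) //.
    by rewrite divr_ge0 ?exprn_ge0 // ltW.
  rewrite ler_pM2r ?invr_gt0 ?exprn_gt0 // lerXn2r ?nnegrE //; first exact: ltW.
  by apply: le_trans bs; exact: ltW.
have [z zz hzy] := open_mapping_det c10 hd hb h0 hA cA yr.
have Pz : enorm (P z) < 1 by exact: stolz_chart_ball.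
exists (P z).
  split; first by apply/unit_ballE.
  by rewrite /eball /=; apply: lt_le_trans seta; exact: stolz_chart_near.
have fP1 : enorm (f (P z)) < 1 by exact: fb.
rewrite -(mobK w1 fP1) -[mob w (f (P z))]/(h z) hzy.
exact: mobK.
Qed.
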